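(* Let $n$ be a positive integer. Then $$\sum_{k_1 \ge \dots \ge k_n \ge 0} R^{\ast}_{(k_{1},\ldots,k_{n})}(x_{1},\dots,x_{n};1,1,w)= \prod_{i=1}^n \frac{1}{1-x_i} \prod_{1 \le i < j \le n} \frac{x_i+x_j+w}{x_i-x_j}\ \operatorname{Pf}_{\chi_{\mathrm{even}}(n) \le i < j \le n} \left(\begin{cases}1, & i=0,\\ \frac{(x_j-x_i)((1+w) + x_i x_j)}{(x_i+x_j+w)(1-x_i x_j)},& i\ge 1\end{cases} \right),$$ where the sum is over all weakly decreasing sequences of $n$ nonnegative integers.
   Context: For a sequence of integers $\boldsymbol{k}=(k_1,\dots,k_n)$ (not necessarily increasing), the modified Robbins polynomial is $$R_{\boldsymbol{k}}^{\ast}(x_{1},\ldots,x_{n};u,v,w)=\frac{\mathbf{ASym}_{x_{1},\ldots,x_{n}}\left[\prod_{1\le i<j\le n}(u x_{i}x_{j}+v+w x_{i})\prod_{i=1}^{n}x_{i}^{k_{i}}\right]}{\prod_{1\le i<j\le n}(x_{j}-x_{i})},$$ where $\mathbf{ASym}_{x_1,\ldots,x_n} F(x_1,\dots,x_n)=\sum_{\sigma\in\mathfrak S_n}\operatorname{sgn}(\sigma)F(x_{\sigma(1)},\dots,x_{\sigma(n)})$. $\chi_{\mathrm{even}}(n)$ equals $1$ if $n$ is even and $0$ if $n$ is odd. So the Pfaffian is over the index set $\{1,\dots,n\}$ for $n$ even and $\{0,1,\dots,n\}$ for $n$ odd. The Pfaffian of a triangular array $(a_{i,j})_{1\le i<j\le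 2m}$ is $\sum \operatorname{sgn}(i_1j_1\dots i_mj_m)\,a_{i_1,j_1}\cdots a_{i_m,j_m}$, summed over all perfect matchings $\{(i_1,j_1),\dots,(i_m,j_m)\}$ of $\{1,\dots,2m\}$ with $i_1<\dots<i_m$ and $i_k<j_k$ for all $k$; for index sets $\{0,\dots,2m-1\}$ one relabels in increasing order. The variables $x_1,\dots,x_n,w$ are indeterminates, and the infinite sum is understood as a formal power series in $x_1,\dots,x_n$; the right-hand side is a rational function expanded as such a power series. *)

(* Defs.v *)
From mathcomp Require Import all_boot all_order all_algebra perm.
From mathcomp Require Import fraction mpoly.

Set Implicit Arguments.
Unset Strict Implicit.
Unset Printing Implicit Defensive.

Import GRing.Theory.
Local Open Scope ring_scope.

(* The library has no multivariate power series: a series in n variables over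
   R is its coefficient function 'X_{1..n} -> R on monomials. *)
Section PowerSeries.
Variables (n : nat) (R : idomainType).

Definition fps : Type := 'X_{1..n} -> R.

Definition fps_of_mpoly (p : {mpoly R[n]}) : fps := fun m => p@_m.

(* Cauchy product; the bound on [mdeg a] is implied by [a <= m] and only makes
   the index type finite. *)
Definition fps_mul (f g : fps) : fps := fun m =>
  \sum_(a : 'X_{1..n < (mdeg m).+1} | (a <= m)%MM) f a * g (m - a)%MM.

(* [s] is the expansion of the rational function [f]: writing f = p / q with
   [q] invertible as a power series, i.e. with invertible constant term, s is
   the unique series such that q s = p. *)
Definition expands_to (f : {fraction {mpoly R[n]}}) (s : fps) : Prop :=
  exists p q : {mpoly R[n]},
    [/\ q@_0%MM \is a GRing.unit,
        f = tofrac p / tofrac q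
      & fps_mul (fps_of_mpoly q) s =1 fps_of_mpoly p].

(* Convergence of an infinite sum in the ring of formal power series: every
   coefficient receives only finitely many nonzero contributions, and these
   add up to the coefficient of [s]. *)
Definition fps_has_sum (I : eqType) (r : I -> fps) (s : fps) : Prop :=
  forall m : 'X_{1..n}, exists A : seq I,
    [/\ uniq A,
        forall i, i \notin A -> r i m = 0
      & s m = \sum_(i <- A) r i m].

Definition sums_to (I : eqType) (f : I -> {fraction {mpoly R[n]}}) (s : fps) :
    Prop :=
  exists r : I -> fps, (forall i, expands_to (f i) (r i)) /\ fps_has_sum r s.

End PowerSeries.

Section RobbinsPfaffian.
Variable F : fieldType.

Definition asym n (G : ('I_n -> F) -> F) (x : 'I_n -> F) : F :=
  \sum_(s : 'S_n) (-1) ^+ s * G (fun i => x (s i)).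

Definition robbins n (k : 'I_n -> int) (x : 'I_n -> F) (u v w : F) : F :=
  asym (fun y => (\prod_(i < n) \prod_(j < n | (i < j)%N)
                     (u * y i * y j + v + w * y i))
                 * \prod_(i < n) y i ^ k i) x
  / \prod_(i < n) \prod_(j < n | (i < j)%N) (x j - x i).

Lemma match_fst_subproof m (k : 'I_m) : (k.*2 < m.*2)%N.
Proof. by rewrite ltn_double. Qed.

Lemma match_snd_subproof m (k : 'I_m) : (k.*2.+1 < m.*2)%N.
Proof. by rewrite ltn_Sdouble. Qed.

Definition match_fst m (k : 'I_m) : 'I_(m.*2) := Ordinal (match_fst_subproof k).
Definition match_snd m (k : 'I_m) : 'I_(m.*2) := Ordinal (match_snd_subproof k).

(* A perfect matching {(i_1, j_1), ..., (i_m, j_m)} of {0, ..., 2m-1} is encoded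
   by the permutation s whose one-line notation is the word i_1 j_1 ... i_m j_m
   (so its sign is that of s), with i_1 < ... < i_m and i_k < j_k. *)
Definition is_matching m (s : 'S_(m.*2)) : bool :=
  [forall k : 'I_m, (s (match_fst k) < s (match_snd k))%N]
  && [forall k : 'I_m, forall l : 'I_m,
        (k < l)%N ==> (s (match_fst k) < s (match_fst l))%N].

Definition pfaffian m (a : 'I_(m.*2) -> 'I_(m.*2) -> F) : F :=
  \sum_(s : 'S_(m.*2) | is_matching s)
    (-1) ^+ s * \prod_(k < m) a (s (match_fst k)) (s (match_snd k)).

Definition chi_even (n : nat) : nat := ~~ odd n.

(* The Pfaffian over the index set {chi_even n, ..., n}, of even cardinality
   2 * uphalf n, relabelled in increasing order: position p is the index
   p + chi_even n, which is at most n, so that [inord] never takes its default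
   value. *)
Definition pfaffian_chi n (a : 'I_n.+1 -> 'I_n.+1 -> F) : F :=
  pfaffian (fun p q : 'I_((uphalf n).*2) =>
    a (inord (p + chi_even n)) (inord (q + chi_even n))).

(* The indices of the array are 0, ..., n whereas the variables x_1, ..., x_n
   are indexed by 'I_n: [unlift ord0] sends 0 to None and i >= 1 to the element
   i - 1 of 'I_n, the index of x_i. Only entries with i < j are used, hence the
   None case is exactly i = 0. *)
Definition pf_entry n (x : 'I_n -> F) (w : F) (i j : 'I_n.+1) : F :=
  match unlift ord0 i, unlift ord0 j with
  | Some i', Some j' =>
      (x j' - x i') * ((1 + w) + x i' * x j')
      / ((x i' + x j' + w) * (1 - x i' * x j'))
  | _, _ => 1
  end.

End RobbinsPfaffian.

(* Rational functions in x_1, ..., x_n over Z[w]; the indeterminate w is the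
   variable of {poly int}. *)
Definition ratfun (n : nat) : fieldType := {fraction {mpoly {poly int}[n]}}.

Definition xvar (n : nat) (i : 'I_n) : ratfun n :=
  tofrac ('X_i : {mpoly {poly int}[n]}).

Definition wvar (n : nat) : ratfun n :=
  tofrac (('X : {poly int})%:MP : {mpoly {poly int}[n]}).

(* Weakly decreasing sequences k_1 >= ... >= k_n >= 0. *)
Definition wdec_seq (n : nat) := {k : n.-tuple nat | sorted geq k}.

Definition wdec_int n (k : wdec_seq n) (i : 'I_n) : int := (tnth (val k) i)%:Z.

(* Main.v *)
From Stdlib Require Import FunctionalExtensionality.
Require Import Defs.
From mathcomp Require Import all_boot all_order all_algebra perm ring zify.
From mathcomp Require Import fraction mpoly.

Set Implicit Arguments.
Unset Strict Implicit.
Unset Printing Implicit Defensive.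

Import GRing.Theory.
Local Open Scope ring_scope.

(** The sum over weakly decreasing sequences k of the monomials x^k is
    geometric: it is the product of the 1/(1 - z_i), where z_i = x_1 ... x_i.
    So the generating function is the antisymmetrisation of
      prod_(i<j) (1 + w x_i + x_i x_j) * prod_i 1/(1 - z_i)
    divided by the Vandermonde product, and the theorem splits into an identity
    of rational functions ([summed_kernelE]) and a convergence argument.

    The rational identity is an induction on the number of variables. Reverse
    the variables and divide by the symmetric factors of the right-hand side;
    the summand becomes [kern], which satisfies
      kern y = first_factor y / (1 - prod y) * kern (y without y_0),
    and the claim is that, up to the number of orderings of a matching, its
    antisymmetrisation is that of a product over disjoint pairs of positions
    of the Pfaffian entry A(a, b) = [pf_kernel w a b] ([asym_kern_pairs]).
    The key is the decomposition
      first_factor y = sum_(k>0) A(y_0, y_k) c_k + (+-1 - prod y)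
    ([first_factor_decomp]), with coefficients c_k = [weight y k] that do not
    involve w; it follows from the partial fraction expansion of
    prod_k (1 + u y_k)/(u + y_k) in u, at u = y_0 + w. After multiplication by
    the product over pairs, the term of index k contains
    A(y_0, y_k) A(y_k, y_k'), where k' is the partner of k: exchanging y_0 and
    y_k' fixes it, so it antisymmetrises to zero. When one position besides 0
    is unpaired, one term survives, in which 0 is paired with that position,
    and all positions being equivalent its coefficient c_1 averages to
    (sum_k c_k)/n, where sum_k c_k = 1 - prod y ([sum_weight]). Either way the
    denominator 1 - prod y cancels. The Pfaffian is brought to the same form by
    expanding along its first row ([even_factorial_pfaffian]).

    For convergence everything is done with polynomials. An antisymmetrised
    polynomial is divisible by the Vandermonde product, which is homogeneous of
    some degree c, so each Robbins polynomial is a polynomial whose terms have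
    degree at least |k| - c. Partial sums over sequences with bounded steps are
    exact geometric sums; multiplied by a common denominator, they differ from
    the expected numerator only in high degree ([sum_robbins_poly]). *)

(** * Partial fractions in the variables *)

Section PartialFractions.
Variable F : fieldType.

(** The two products have the same leading coefficient. With a first variable a
    added, the difference P - Y Q for the others becomes
    (1 + a X) (P - Y Q) + (1 - a^2) Y Q, where Q has degree n. *)
Lemma size_inversion_diff n (y : 'I_n -> F) :
  (size (\prod_k (1 + y k *: 'X) - (\prod_k y k) *: \prod_k ('X + (y k)%:P))%R
    <= n)%N.
Proof.
elim: n y => [|n IHn] y; first by rewrite !big_ord0 scale1r subrr size_poly0.
rewrite !big_ord_recl /=.
set P := \prod_(i < n) (_ + _); set Y := \prod_(i < n) y _.
set Q := \prod_(i < n) (_ + _); set a := y ord0.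
have -> : (1 + a *: 'X) * P - (a * Y) *: (('X + a%:P) * Q)
    = (1 + a *: 'X) * (P - Y *: Q) + ((1 - a ^+ 2) * Y) *: Q.
  by rewrite -!mul_polyC !(rmorphM, rmorphB, rmorph1, rmorphXn) /=; ring.
have szQ : (size Q <= n.+1)%N.
  rewrite (leq_trans (size_poly_prod_leq _ _)) //.
  rewrite (eq_bigr (fun=> 2%N)) => [|i _]; last by rewrite size_XaddC.
  by rewrite sum_nat_const card_ord muln2 -addnn; lia.
rewrite (leq_trans (size_polyD _ _)) // geq_max.
rewrite (leq_trans (size_scale_leq _ _) szQ) andbT.
rewrite (leq_trans (size_polyMleq _ _)) //.
have := IHn (fun i => y (lift ord0 i)); rewrite -/P -/Y -/Q => szPQ.
have : (size (1 + a *: 'X)%R <= 2)%N.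
  rewrite (leq_trans (size_polyD _ _)) // geq_max size_poly1 /=.
  by rewrite (leq_trans (size_scale_leq _ _)) // size_polyX.
by move=> sz2; rewrite -subn1 leq_subLR (leq_add sz2 szPQ).
Qed.

(** Lagrange interpolation in u: both sides times prod_k (u + y_k) are
    polynomials in u whose difference has degree less than n and vanishes at
    the n points - y_k. *)
Lemma inversion_partial_fraction n (y : 'I_n -> F) u :
  injective y -> (forall k, u + y k != 0) ->
  \prod_k ((1 + u * y k) / (u + y k)) =
  \prod_k y k + \sum_k (1 - y k ^+ 2) / (u + y k)
                       * \prod_(i | i != k) ((1 - y i * y k) / (y i - y k)).
Proof.
move=> inj_y uy_neq0.
pose res k := (1 - y k ^+ 2) * \prod_(i | i != k) ((1 - y i * y k) / (y i - y k)).
pose rem := \sum_k res k *: \prod_(i | i != k) ('X + (y i)%:P) : {poly F}.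
have yB_neq0 i k : i != k -> y i - y k != 0.
  by move=> neq_ik; rewrite subr_eq0 (inj_eq inj_y).
have poly_id : \prod_k (1 + y k *: 'X) - (\prod_k y k) *: \prod_k ('X + (y k)%:P)
                 = rem.
  apply/eqP; rewrite -subr_eq0; apply/eqP.
  apply: (@roots_geq_poly_eq0 _ _ [seq - y k | k <- enum 'I_n]).
  (* At - y_k only the k-th interpolation term survives. *)
  - apply/allP=> _ /mapP[k _ ->]; rewrite rootE /rem.
    rewrite !(hornerD, hornerN) hornerZ !horner_prod horner_sum.
    rewrite [\prod_(i < n) ('X + _).[_]](bigD1 k) //= hornerD hornerX hornerC.
    rewrite addNr mul0r mulr0 subr0 [X in _ - X](bigD1 k) //=.
    rewrite [X in _ - (_ + X)]big1 => [|j neq_jk].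
      rewrite addr0 hornerZ horner_prod /res -mulrA -big_split /=.
      rewrite (bigD1 k) //= hornerD hornerZ hornerX hornerC mulrN -expr2.
      rewrite subr_eq0; apply/eqP; congr (_ * _); apply: eq_bigr => i neq_ik.
      rewrite !hornerE.
      by rewrite (addrC (- y k)) divfK ?yB_neq0 // mulrN.
    rewrite hornerZ horner_prod (bigD1 k) 1?eq_sym //=.
    by rewrite hornerD hornerX hornerC addNr mul0r mulr0.
  - by rewrite map_inj_uniq ?enum_uniq // => i k /oppr_inj /inj_y.
  rewrite size_map size_enum_ord (leq_trans (size_polyD _ _)) // geq_max.
  rewrite size_inversion_diff size_polyN (leq_trans (size_sum _ _ _)) //.
  apply/bigmax_leqP=> k _; rewrite (leq_trans (size_scale_leq _ _)) //.
  rewrite (leq_trans (size_poly_prod_leq _ _)) //.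
  rewrite (eq_bigr (fun=> 2%N)) => [|i _]; last by rewrite size_XaddC.
  rewrite sum_nat_const muln2 -addnn cardC1 card_ord.
  by have := ltn_ord k; lia.
have /(congr1 (fun p => p.[u])) := poly_id.
rewrite /rem hornerD hornerN hornerZ !horner_prod horner_sum => /eqP.
rewrite subr_eq => /eqP num_id; rewrite prodf_div.
have -> : \prod_i (1 + u * y i) = \prod_(i < n) (1 + y i *: 'X).[u].
  by apply: eq_bigr => i _; rewrite !hornerE mulrC.
rewrite num_id mulrDl addrC; congr (_ + _).
  rewrite -mulrA -prodf_div [X in _ * X]big1 ?mulr1 // => k _.
  by rewrite !hornerE divff // addrC.
rewrite mulr_suml; apply: eq_bigr => k _; rewrite hornerZ horner_prod /res.
rewrite [X in _ / X](bigD1 k) //= invfM.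
have -> : \prod_(i | i != k) ('X + (y i)%:P).[u] = \prod_(i | i != k) (u + y i).
  by apply: eq_bigr => i _; rewrite !hornerE.
have : \prod_(i < n | i != k) (u + y i) != 0 by apply/prodf_neq0.
by move: (\prod_(i < n | i != k) (u + y i)) (uy_neq0 k) => p uk p0; field; apply/andP.
Qed.

(** These are the coefficients of the Pfaffian entries in
    [first_factor_decomp]; multiplied by y_k - 1, they are the residues in
    [inversion_partial_fraction]. *)
Definition weight n (y : 'I_n -> F) (k : 'I_n) : F :=
  - (1 + y k) * \prod_(i | i != k) ((1 - y i * y k) / (y i - y k)).

(** This is the partial fraction expansion at u = -1, where every factor of the
    product equals -1. *)
Lemma sum_weight n (y : 'I_n -> F) :
  injective y -> (forall k, y k != 1) ->
  \sum_k weight y k = (-1) ^+ n - \prod_k y k.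
Proof.
move=> inj_y y1.
have y1' k : -1 + y k != 0 by rewrite addrC subr_eq0.
have := inversion_partial_fraction inj_y y1'.
have -> : \prod_k ((1 + -1 * y k) / (-1 + y k)) = (-1) ^+ n.
  rewrite -[n in RHS]card_ord -prodr_const; apply: eq_bigr => k _.
  by have := y1' k => ?; field.
move->; rewrite addrC addKr; apply: eq_bigr => k _; rewrite /weight.
congr (_ * _); have := y1' k => ?; by field.
Qed.

Lemma weight_perm n (y : 'I_n -> F) (s : 'S_n) k :
  weight (fun i => y (s i)) k = weight y (s k).
Proof.
rewrite /weight [in RHS](reindex_inj (@perm_inj _ s)) /=; congr (_ * _).
by apply: eq_bigl => i; rewrite (inj_eq perm_inj).
Qed.

Variable w : F.

Definition pf_kernel (a b : F) : F :=
  (b - a) * ((1 + w) + a * b) / ((a + b + w) * (1 - a * b)).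

Lemma pf_kernelC a b : pf_kernel a b = - pf_kernel b a.
Proof.
by rewrite /pf_kernel (addrC a b) (mulrC a b) -!mulNr opprB.
Qed.

(** Together with 1 / (1 - prod_i y_i), these are the factors of [kern] below
    that involve the first variable. *)
Definition first_factor n (y : 'I_n.+1 -> F) : F :=
  (1 - y ord0)
  * \prod_(i < n) ((1 + w * y (lift ord0 i) + y (lift ord0 i) * y ord0)
                   / (y (lift ord0 i) + y ord0 + w)).

(** Put x = y_0 and u = x + w. The factor 1 - x y_k in the denominator of the
    Pfaffian entry cancels against the weight, so that each summand becomes
    affine in x for fixed u, with coefficients supplied by
    [inversion_partial_fraction] at u and [sum_weight]. *)
Lemma first_factor_decomp n (y : 'I_n.+1 -> F) :
  injective y -> (forall k, y k != 1) ->
  (forall i j, i != j -> y i + y j + w != 0) ->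
  (forall i j, i != j -> 1 - y i * y j != 0) ->
  first_factor y
  = \sum_(k < n) pf_kernel (y ord0) (y (lift ord0 k)) * weight y (lift ord0 k)
    + ((-1) ^+ n - \prod_i y i).
Proof.
move=> inj_y y1 yDw yM1; set x := y ord0; pose z (k : 'I_n) := y (lift ord0 k).
have inj_z : injective z by move=> i j /inj_y /lift_inj.
have xz k : x + w + z k != 0 by rewrite addrAC; apply: yDw; apply: neq_lift.
have xz1 k : 1 - x * z k != 0 by apply: yM1; apply: neq_lift.
have xBz k : x - z k != 0.
  by rewrite subr_eq0 (inj_eq inj_y); apply: neq_lift.
pose d k := \prod_(i | i != k) ((1 - z i * z k) / (z i - z k)).
have weightE k : weight y (lift ord0 k)
    = - (1 + z k) * ((1 - x * z k) / (x - z k)) * d k.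
  rewrite /weight -mulrA; congr (_ * _).
  rewrite big_mkcond big_ord_recl /=; congr (_ * _).
  rewrite [RHS]big_mkcond /=; apply: eq_bigr => i _.
  by rewrite (inj_eq lift_inj).
(* The summand is affine in x once x + w is taken as a parameter. *)
have termE k : pf_kernel x (z k) * weight y (lift ord0 k)
    = - weight z k + (1 - x) * ((1 - z k ^+ 2) / (x + w + z k) * d k).
  rewrite weightE /pf_kernel /weight -/(d k).
  by field; rewrite xz xz1 xBz.
rewrite (eq_bigr _ (fun k _ => termE k)) big_split /= -mulr_sumr sumrN.
rewrite sum_weight // => [|k]; last exact: y1.
have := inversion_partial_fraction inj_z xz; rewrite -/d => /esym/(canRL (addKr _)) ->.
rewrite big_ord_recl -/x -/(z _) /first_factor.
have -> : \prod_(i < n) ((1 + w * y (lift ord0 i) + y (lift ord0 i) * y ord0)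
                   / (y (lift ord0 i) + y ord0 + w))
   = \prod_k ((1 + (x + w) * z k) / (x + w + z k)).
  apply: eq_bigr => k _; rewrite -/x -/(z k); congr (_ / _); ring.
rewrite -/x; set P := \prod_k (_ / _).
change (\prod_(i < n) y (lift ord0 i)) with (\prod_k z k); ring.
Qed.

End PartialFractions.

(** * Sums over permutations, matchings and Pfaffians *)

Section PermutationSums.
Variable R : pzRingType.

(** The permutations sending i to j are exactly the [lift_perm i j s]. *)
Lemma sum_perm_lift n (i j : 'I_n.+1) (f : 'S_n.+1 -> R) :
  \sum_(s : 'S_n.+1 | s i == j) f s = \sum_(s : 'S_n) f (lift_perm i j s).
Proof.
have inj_h : injective (lift_perm i j).
  move=> s t eq_st; apply/permP => k; apply: (@lift_inj _ j).
  by rewrite -!(lift_perm_lift i) eq_st.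
rewrite (eq_bigl (mem [set lift_perm i j s | s in [set: 'S_n]])) => [|s].
  by rewrite big_imset /= => [|s t _ _ /inj_h //]; apply: eq_bigl => s; rewrite inE.
apply/eqP/imsetP => [s_i | [t _ ->]]; last exact: lift_perm_id.
have [g gP] : exists g : 'I_n -> 'I_n, forall k, lift j (g k) = s (lift i k).
  suff quo k : exists l, lift j l = s (lift i k) by apply: fin_all_exists quo.
  case: (unliftP j (s (lift i k))) => [l ->|]; first by exists l.
  by rewrite -s_i => /perm_inj/eqP; rewrite eq_sym (negPf (neq_lift i k)).
have inj_g : injective g.
  by move=> k l /(congr1 (lift j)); rewrite !gP => /perm_inj/lift_inj.
exists (perm inj_g); first by rewrite inE.
apply/permP => k; case: (unliftP i k) => [k'|] ->; last by rewrite lift_perm_id.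
by rewrite lift_perm_lift permE gP.
Qed.

Lemma sum_sign_perm_lift n (i : 'I_n.+1) (f : 'S_n.+1 -> R) :
  \sum_(s : 'S_n.+1) (-1) ^+ s * f s =
  \sum_(j < n.+1) (-1) ^+ (i + j)
     * \sum_(s : 'S_n) (-1) ^+ s * f (lift_perm i j s).
Proof.
rewrite (partition_big (fun s : 'S_n.+1 => s i) predT) //=.
apply: eq_bigr => j _; rewrite sum_perm_lift mulr_sumr; apply: eq_bigr => s _.
by rewrite odd_lift_perm !signr_addb !signr_odd exprD !mulrA.
Qed.

Lemma sum_perm_antisym n (t : 'S_n) (f : 'S_n -> R) :
  (forall x : R, x = - x -> x = 0) ->
  (forall s, f (t * s)%g = - f s) -> \sum_(s : 'S_n) f s = 0.
Proof.
move=> two_reg f_t; apply: two_reg.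
rewrite -sumrN [LHS](reindex_inj (mulgI t)) /=.
by apply: eq_bigr => s _; rewrite f_t.
Qed.

End PermutationSums.

Section Matchings.

Lemma match_fst_inj m : injective (@match_fst m).
Proof. by move=> i j /(congr1 val) /= /double_inj /val_inj. Qed.

Lemma match_snd_inj m : injective (@match_snd m).
Proof. by move=> i j /(congr1 val) /= [] /double_inj /val_inj. Qed.

Lemma match_fst_neq_snd m (i j : 'I_m) : match_fst i != match_snd j.
Proof. by apply/eqP => /(congr1 (odd \o val)); rewrite /= !odd_double. Qed.

Lemma match_fst_or_snd m (p : 'I_(m.*2)) :
  {k : 'I_m | p = match_fst k} + {k : 'I_m | p = match_snd k}.
Proof.
have lt_p : (p./2 < m)%N by rewrite ltn_half_double.
have := odd_double_half p; case: (odd p) => /= def_p; [right | left];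
  by exists (Ordinal lt_p); apply: val_inj => /=; rewrite -{1}def_p.
Qed.

Lemma match_fst_lift m (k : 'I_m) :
  match_fst (lift ord0 k) = lift ord0 (lift ord0 (match_fst k)) :> 'I_(m.*2.+2).
Proof. by apply: val_inj. Qed.

Lemma match_snd_lift m (k : 'I_m) :
  match_snd (lift ord0 k) = lift ord0 (lift ord0 (match_snd k)) :> 'I_(m.*2.+2).
Proof. by apply: val_inj. Qed.

Lemma match_fst0 m : match_fst (ord0 : 'I_m.+1) = ord0 :> 'I_(m.*2.+2).
Proof. exact: val_inj. Qed.

Lemma match_snd0 m : match_snd (ord0 : 'I_m.+1) = lift ord0 ord0 :> 'I_(m.*2.+2).
Proof. exact: val_inj. Qed.

Variable F : fieldType.

(** Permuting the pairs, or exchanging the two elements of one pair, leaves the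
    signed product over the pairs invariant, and such permutations reach every
    position. *)
Lemma pairing_transitive m (p : 'I_(m.+1.*2)) :
  exists h : 'S_(m.+1.*2), h (match_fst ord0) = p /\
    forall a : 'I_(m.+1.*2) -> 'I_(m.+1.*2) -> F,
      (forall i j, a i j = - a j i) ->
      (-1) ^+ h * \prod_k a (h (match_fst k)) (h (match_snd k))
      = \prod_k a (match_fst k) (match_snd k).
Proof.
pose u k : 'S_(m.+1.*2) := (tperm (match_fst ord0) (match_fst k)
                            * tperm (match_snd ord0) (match_snd k))%g.
have u_fst k i : u k (match_fst i) = match_fst (tperm ord0 k i).
  rewrite permM -inj_tperm; last exact: match_fst_inj.
  by apply: tpermD; rewrite eq_sym match_fst_neq_snd.
have u_snd k i : u k (match_snd i) = match_snd (tperm ord0 k i).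
  rewrite permM (tpermD (match_fst_neq_snd _ _) (match_fst_neq_snd _ _)).
  by rewrite -inj_tperm //; apply: match_snd_inj.
have u_even k : (-1) ^+ u k = 1 :> F.
  rewrite odd_permM !odd_tperm (inj_eq (@match_fst_inj _)).
  by rewrite (inj_eq (@match_snd_inj _)) addbb.
have [[k ->]|[k ->]] := match_fst_or_snd p.
  exists (u k); split=> [|a _]; first by rewrite u_fst tpermL.
  rewrite u_even mul1r [RHS](reindex_inj (@perm_inj _ (tperm ord0 k))) /=.
  by apply: eq_bigr => i _; rewrite u_fst u_snd.
exists (u k * tperm (match_fst k) (match_snd k))%g; split=> [|a aN].
  by rewrite permM u_fst tpermL tpermL.
rewrite odd_permM signr_addb u_even mul1r odd_tperm match_fst_neq_snd expr1.
rewrite mulN1r; under eq_bigr do rewrite permM u_fst permM u_snd.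
pose t := tperm (match_fst k) (match_snd k).
transitivity (- \prod_i a (t (match_fst i)) (t (match_snd i))).
  by congr (- _); rewrite [RHS](reindex_inj (@perm_inj _ (tperm ord0 k))).
rewrite (bigD1 k) //= [RHS](bigD1 k) //= /t tpermL tpermR aN mulNr opprK.
congr (_ * _); apply: eq_bigr => i neq_ik.
rewrite !tpermD // ?(inj_eq (@match_fst_inj _)) ?(inj_eq (@match_snd_inj _));
  by rewrite ?match_fst_neq_snd // eq_sym ?match_fst_neq_snd.
Qed.

(** Averaging over positions: by [pairing_transitive] the left-hand sum does not
    depend on p. *)
Lemma sum_pairing_position m (a : 'I_(m.+1.*2) -> 'I_(m.+1.*2) -> F)
    (W : 'S_(m.+1.*2) -> 'I_(m.+1.*2) -> F) (p : 'I_(m.+1.*2)) :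
    (forall i j, a i j = - a j i) ->
    (forall h s q, W (h * s)%g q = W s (h q)) ->
  (m.+1.*2)%:R * \sum_(s : 'S_(m.+1.*2)) (-1) ^+ s *
     ((\prod_k a (s (match_fst k)) (s (match_snd k))) * W s p)
  = \sum_(s : 'S_(m.+1.*2)) (-1) ^+ s *
     ((\prod_k a (s (match_fst k)) (s (match_snd k))) * \sum_q W s q).
Proof.
move=> aN W_act.
pose S q := \sum_(s : 'S_(m.+1.*2)) (-1) ^+ s *
     ((\prod_k a (s (match_fst k)) (s (match_snd k))) * W s q).
have S_const q : S q = S (match_fst ord0).
  have [h [h0 hP]] := pairing_transitive q.
  rewrite [RHS](reindex_inj (mulgI h)) /=; apply: eq_bigr => s _.
  rewrite odd_permM signr_addb W_act h0 [(-1) ^+ h * _]mulrC -mulrA.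
  congr (_ * _); rewrite mulrA; congr (_ * _).
  rewrite -(hP (fun i j => a (s i) (s j))) //; congr (_ * _).
  by apply: eq_bigr => k _; rewrite !permM.
rewrite -/(S p) S_const.
transitivity (\sum_q S q).
  rewrite [RHS](eq_bigr (fun=> S (match_fst ord0))) => [|q _]; last exact: S_const.
  by rewrite sumr_const card_ord mulr_natl.
rewrite exchange_big /=; apply: eq_bigr => s _.
by rewrite !mulr_sumr.
Qed.

(** 2 * 4 * ... * (2m), the number of orderings of a perfect matching of 2m
    points: permute the m pairs and order each of them. *)
Definition even_factorial m : nat := \prod_(i < m) i.+1.*2.

Lemma even_factorialS m : even_factorial m.+1 = (m.+1.*2 * even_factorial m)%N.
Proof. by rewrite /even_factorial big_ord_recr /= mulnC. Qed.

(** The permutation that starts with the letters 0 and j + 1 and orders the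
    remaining letters as s does: pairing 0 with j + 1 first, then as in s. *)
Definition lift_perm2 m (j : 'I_(m.*2.+1)) (s : 'S_(m.*2)) : 'S_(m.+1.*2) :=
  lift_perm ord0 ord0 (lift_perm ord0 j s).

Lemma sign_lift_perm2 m (j : 'I_(m.*2.+1)) (s : 'S_(m.*2)) :
  (-1) ^+ lift_perm2 j s = (-1) ^+ j * (-1) ^+ s :> F.
Proof. by rewrite /lift_perm2 !odd_lift_perm /= !signr_addb !signr_odd. Qed.

Lemma lift_perm2_0 m (j : 'I_(m.*2.+1)) (s : 'S_(m.*2)) :
  lift_perm2 j s (match_fst ord0) = ord0.
Proof. by rewrite match_fst0 /lift_perm2 lift_perm_id. Qed.

Lemma lift_perm2_1 m (j : 'I_(m.*2.+1)) (s : 'S_(m.*2)) :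
  lift_perm2 j s (match_snd ord0) = lift ord0 j.
Proof. by rewrite match_snd0 /lift_perm2 lift_perm_lift lift_perm_id. Qed.

Lemma lift_perm2_fst m (j : 'I_(m.*2.+1)) (s : 'S_(m.*2)) k :
  lift_perm2 j s (match_fst (lift ord0 k)) = lift ord0 (lift j (s (match_fst k))).
Proof. by rewrite match_fst_lift /lift_perm2 !lift_perm_lift. Qed.

Lemma lift_perm2_snd m (j : 'I_(m.*2.+1)) (s : 'S_(m.*2)) k :
  lift_perm2 j s (match_snd (lift ord0 k)) = lift ord0 (lift j (s (match_snd k))).
Proof. by rewrite match_snd_lift /lift_perm2 !lift_perm_lift. Qed.

Lemma sum_perm_fix0 m (f : 'S_(m.+1.*2) -> F) :
  \sum_(s : 'S_(m.+1.*2) | s ord0 == ord0) f s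
  = \sum_(j < m.*2.+1) \sum_(s : 'S_(m.*2)) f (lift_perm2 j s).
Proof.
rewrite sum_perm_lift (partition_big (fun s : 'S_(m.*2.+1) => s ord0) predT) //=.
by apply: eq_bigr => j _; rewrite sum_perm_lift.
Qed.

(** The position holding the letter 0 can neither be the second of its pair nor
    come after another first element. *)
Lemma is_matching0 m (s : 'S_(m.+1.*2)) : is_matching s -> s ord0 == ord0.
Proof.
case/andP=> /forallP lt_pair /forallP lt_fst.
have [[k def_p]|[k def_p]] := match_fst_or_snd ((s^-1)%g ord0 : 'I_(m.+1.*2)).
  have [k0 | k_gt0] := posnP k.
    rewrite -(inj_eq (@perm_inj _ (s^-1)%g)) permK def_p.
    by apply/eqP/val_inj; rewrite /= k0.
  have := forallP (lt_fst ord0) k; rewrite k_gt0 -def_p permKV /=.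
  by rewrite ltn0.
by have := lt_pair k; rewrite -def_p permKV ltn0.
Qed.

Lemma ltn_lift n (h : 'I_n) (i j : 'I_n.-1) : (lift h i < lift h j)%N = (i < j)%N.
Proof. by rewrite /= /bump; do 2 case: leqP => //; lia. Qed.

Lemma is_matching_lift m (j : 'I_(m.*2.+1)) (s : 'S_(m.*2)) :
  is_matching (lift_perm2 j s : 'S_(m.+1.*2)) = is_matching s.
Proof.
have ltP (p q : 'I_(m.*2)) :
  (lift ord0 (lift j p) < (lift ord0 (lift j q) : 'I_(m.*2.+2)))%N = (p < q)%N.
  by rewrite !ltn_lift.
apply/andP/andP=> -[/forallP lt_pair /forallP lt_fst]; split; apply/forallP=> k.
- by have := lt_pair (lift ord0 k); rewrite lift_perm2_fst lift_perm2_snd ltP.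
- apply/forallP=> l; have := forallP (lt_fst (lift ord0 k)) (lift ord0 l).
  by rewrite !lift_perm2_fst ltP ltn_lift.
- have [k'|] := unliftP ord0 k => ->; last by rewrite lift_perm2_0 lift_perm2_1.
  by rewrite lift_perm2_fst lift_perm2_snd ltP.
apply/forallP=> l; have [l'|] := unliftP ord0 l => ->; last by rewrite ltn0.
have [k'|] := unliftP ord0 k => ->; last by rewrite lift_perm2_0 lift_perm2_fst.
rewrite !lift_perm2_fst ltP ltn_lift; exact: (forallP (lt_fst k')).
Qed.

(** Expansion of the Pfaffian along its first row: a matching is determined by
    the partner of 0 and a matching of the other points. *)
Lemma pfaffian_expand m (a : 'I_(m.+1.*2) -> 'I_(m.+1.*2) -> F) :
  pfaffian a = \sum_(j < m.*2.+1) (-1) ^+ j * (a ord0 (lift ord0 j)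
    * pfaffian (fun p q => a (lift ord0 (lift j p)) (lift ord0 (lift j q)))).
Proof.
rewrite /pfaffian big_mkcond /=.
rewrite (bigID (fun s : 'S_(m.+1.*2) => s ord0 == ord0)) /= [X in _ + X]big1 ?addr0.
  rewrite sum_perm_fix0; apply: eq_bigr => j _; rewrite !mulr_sumr [RHS]big_mkcond.
  apply: eq_bigr => s _; rewrite is_matching_lift; case: ifP => // _.
  rewrite sign_lift_perm2 -!mulrA; congr (_ * _).
  rewrite big_ord_recl lift_perm2_0 lift_perm2_1 mulrCA; congr (_ * (_ * _)).
  by apply: eq_bigr => k _; rewrite lift_perm2_fst lift_perm2_snd.
by move=> s; case: ifP => // /is_matching0 ->.
Qed.

(** For an alternating array the ordering conditions on matchings can be
    dropped. Induction along the first row: by [sum_pairing_position] the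
    permutations sending position 0 to the letter 0 carry 1/(2m) of the sum. *)
Lemma even_factorial_pfaffian m (a : 'I_(m.*2) -> 'I_(m.*2) -> F) :
  (forall i j, a i j = - a j i) ->
  (even_factorial m)%:R * pfaffian a
  = \sum_(s : 'S_(m.*2)) (-1) ^+ s * \prod_k a (s (match_fst k)) (s (match_snd k)).
Proof.
elim: m a => [|m IHm] a aN.
  rewrite /even_factorial big_ord0 mul1r /pfaffian; apply: eq_bigl => s.
  by apply/andP; split; apply/forallP; case.
transitivity ((m.+1.*2)%:R * \sum_(s : 'S_(m.+1.*2)) (-1) ^+ s *
     ((\prod_k a (s (match_fst k)) (s (match_snd k))) * (s ord0 == ord0)%:R)).
  rewrite even_factorialS natrM -mulrA; congr (_ * _).
  transitivity (\sum_(s : 'S_(m.+1.*2) | s ord0 == ord0) (-1) ^+ s *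
     \prod_k a (s (match_fst k)) (s (match_snd k))); last first.
    rewrite big_mkcond; apply: eq_bigr => s _.
    by case: eqP; rewrite ?(mulr1, mulr0).
  rewrite sum_perm_fix0 pfaffian_expand mulr_sumr; apply: eq_bigr => j _.
  rewrite mulrCA (mulrCA _%:R) IHm => [|p q]; last exact: aN.
  rewrite !mulr_sumr; apply: eq_bigr => s _.
  rewrite sign_lift_perm2 -!mulrA; congr (_ * _).
  rewrite big_ord_recl lift_perm2_0 lift_perm2_1 mulrCA; congr (_ * (_ * _)).
  by apply: eq_bigr => k _; rewrite lift_perm2_fst lift_perm2_snd.
(* Exactly one position q of s holds the letter 0. *)
rewrite (sum_pairing_position (W := fun s q => (s q == ord0)%:R)) //; last first.
  by move=> h s q; rewrite permM.
apply: eq_bigr => s _; rewrite (bigD1 ((s^-1)%g ord0)) //= permKV eqxx.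
rewrite [X in _ + X]big1 ?addr0 ?mulr1 // => q.
by move/eqP=> neq_q; case: eqP => // sq0; case: neq_q; rewrite -sq0 permK.
Qed.

End Matchings.

(** * Antisymmetrisation *)

Section AsymTheory.
Variable F : fieldType.

Lemma prod_perm n (y : 'I_n -> F) (s : 'S_n) : \prod_i y (s i) = \prod_i y i.
Proof. by rewrite [RHS](reindex_inj (@perm_inj _ s)). Qed.

Lemma asymD n (G H : ('I_n -> F) -> F) x :
  asym (fun y => G y + H y) x = asym G x + asym H x.
Proof. by rewrite /asym -big_split; apply: eq_bigr => s _; rewrite mulrDr. Qed.

Lemma asym_sum n (I : finType) (G : I -> ('I_n -> F) -> F) x :
  asym (fun y => \sum_i G i y) x = \sum_i asym (G i) x.
Proof.
by rewrite /asym exchange_big; apply: eq_bigr => s _; rewrite mulr_sumr.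
Qed.

Lemma eq_asym n (G H : ('I_n -> F) -> F) x :
  (forall s : 'S_n, G (fun i => x (s i)) = H (fun i => x (s i))) ->
  asym G x = asym H x.
Proof. by move=> eqGH; apply: eq_bigr => s _; rewrite eqGH. Qed.

Lemma asym_tperm_eq0 n (p q : 'I_n) (G : ('I_n -> F) -> F) x :
    (forall k, k.+1%:R != 0 :> F) -> p != q ->
    (forall y, G (fun i => y (tperm p q i)) = G y) ->
  asym G x = 0.
Proof.
move=> char0 neq_pq G_inv; apply: (@sum_perm_antisym _ _ (tperm p q)) => [z|s].
  move/eqP; rewrite -subr_eq0 opprK -mulr2n -mulr_natr mulf_eq0.
  by rewrite (negPf (char0 1%N)) orbF => /eqP.
rewrite odd_permM signr_addb odd_tperm neq_pq expr1 mulN1r mulNr.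
rewrite -[in RHS]G_inv; congr (- (_ * G _)).
by apply: functional_extensionality => i; rewrite permM.
Qed.

(** Expansion along the first position, for a summand whose factor B is
    symmetric in the remaining variables. *)
Lemma asym_mul_first n (B : ('I_n.+1 -> F) -> F) (G : ('I_n -> F) -> F) x :
    (forall j s, B (fun i => x (lift_perm ord0 j s i))
                 = B (fun i => x (lift_perm ord0 j 1%g i))) ->
  asym (fun y => B y * G (fun i => y (lift ord0 i))) x
  = \sum_(j < n.+1) (-1) ^+ j * (B (fun i => x (lift_perm ord0 j 1%g i))
                        * asym G (fun i => x (lift j i))).
Proof.
move=> B_inv; rewrite /asym (sum_sign_perm_lift ord0); apply: eq_bigr => j _.
rewrite add0n; congr (_ * _); rewrite mulr_sumr; apply: eq_bigr => s _.
rewrite B_inv mulrCA; congr (_ * (_ * G _)).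
by apply: functional_extensionality => i; rewrite lift_perm_lift.
Qed.

End AsymTheory.

Section Generic.
Variables (F : fieldType) (w : F).

(** Conditions under which no denominator in the identity vanishes; they pass
    to subfamilies, as the induction requires. *)
Definition generic n (x : 'I_n -> F) : Prop :=
  [/\ injective x,
      forall i j, i != j -> x i + x j + w != 0
    & forall k (f : 'I_k.+1 -> 'I_n), injective f -> \prod_i x (f i) != 1].

Lemma generic_comp k n (f : 'I_k -> 'I_n) (x : 'I_n -> F) :
  injective f -> generic x -> generic (fun i => x (f i)).
Proof.
move=> inj_f [inj_x xDw xM1]; split=> [|i j neq_ij|l g inj_g].
- exact: inj_comp inj_x inj_f.
- by apply: xDw; rewrite (inj_eq inj_f).
exact: (xM1 l (f \o g) (inj_comp inj_f inj_g)).
Qed.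

Lemma generic_neq1 n (x : 'I_n -> F) k : generic x -> x k != 1.
Proof.
case=> _ _ xM1; have := xM1 0%N (fun=> k); rewrite big_ord1; apply.
by move=> i j _; rewrite !ord1.
Qed.

Lemma generic_mul_neq1 n (x : 'I_n -> F) i j :
  generic x -> i != j -> 1 - x i * x j != 0.
Proof.
case=> _ _ xM1 neq_ij; rewrite subr_eq0 eq_sym.
have := xM1 1%N (fun k => if k == ord0 then i else j).
rewrite big_ord_recl big_ord1 /=; apply=> k l.
case: (unliftP ord0 k) => [k'|] ->; case: (unliftP ord0 l) => [l'|] -> //=.
- by rewrite (ord1 k') (ord1 l').
- by move=> eq_ij; rewrite eq_ij eqxx in neq_ij.
by move=> eq_ij; rewrite eq_ij eqxx in neq_ij.
Qed.

Lemma generic_prod_neq1 n (x : 'I_n.+1 -> F) : generic x -> 1 - \prod_i x i != 0.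
Proof. by case=> _ _ xM1; rewrite subr_eq0 eq_sym; apply: (xM1 n id). Qed.


(** If k' is the partner of k, then A(y_p, y_k) A(y_k, y_k') is invariant under
    the exchange of y_p and y_k', both factors changing sign; hence the
    antisymmetrisation vanishes. *)
Lemma asym_shared_pair N m (e : 'I_(m.*2) -> 'I_N) (p : 'I_N) (k : 'I_(m.*2))
    (C : ('I_N -> F) -> F) x :
    (forall k, k.+1%:R != 0 :> F) ->
    injective e -> (forall i, e i != p) ->
    (forall y q, q != e k -> C (fun i => y (tperm p q i)) = C y) ->
  asym (fun y => pf_kernel w (y p) (y (e k)) * C y
     * \prod_i pf_kernel w (y (e (match_fst i))) (y (e (match_snd i)))) x = 0.
Proof.
move=> char0 inj_e neq_ep C_inv.
have shared (k1 k2 : 'I_(m.*2)) i0 y :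
    (forall y' q, q != e k1 -> C (fun i => y' (tperm p q i)) = C y') ->
    [/\ k1 = match_fst i0 & k2 = match_snd i0]
    \/ [/\ k1 = match_snd i0 & k2 = match_fst i0] ->
  pf_kernel w (y (tperm p (e k2) p)) (y (tperm p (e k2) (e k1)))
   * C (fun i => y (tperm p (e k2) i))
   * \prod_i pf_kernel w (y (tperm p (e k2) (e (match_fst i))))
                         (y (tperm p (e k2) (e (match_snd i))))
  = pf_kernel w (y p) (y (e k1)) * C y
   * \prod_i pf_kernel w (y (e (match_fst i))) (y (e (match_snd i))).
  move=> C_inv' pairk.
  have neq_k12 : k1 != k2.
    by case: pairk => -[-> ->]; rewrite 1?[_ == match_fst _]eq_sym match_fst_neq_snd.
  have fix_e z : z != k2 -> tperm p (e k2) (e z) = e z.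
    by move=> neq_z; rewrite tpermD // eq_sym ?(inj_eq inj_e).
  have neq_fst i : i != i0 -> match_fst i != k2.
    move=> neq_i; case: pairk => -[_ ->]; first exact: match_fst_neq_snd.
    by rewrite (inj_eq (@match_fst_inj _)).
  have neq_snd i : i != i0 -> match_snd i != k2.
    move=> neq_i; case: pairk => -[_ ->]; last by rewrite eq_sym match_fst_neq_snd.
    by rewrite (inj_eq (@match_snd_inj _)).
  rewrite C_inv' ?(inj_eq inj_e) 1?eq_sym // tpermL fix_e //.
  rewrite (bigD1 i0) //= [in RHS](bigD1 i0) //=.
  under eq_bigr => i neq_i do
    rewrite (fix_e _ (neq_fst i neq_i)) (fix_e _ (neq_snd i neq_i)).
  case: pairk => -[def_k1 def_k2]; rewrite -def_k1 -def_k2 tpermR fix_e //.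
    rewrite (pf_kernelC w (y (e k2))) (pf_kernelC w (y p)); ring.
  rewrite (pf_kernelC w (y p)) (pf_kernelC w (y (e k2)) (y (e k1))); ring.
have [[i0 def_k]|[i0 def_k]] := match_fst_or_snd k.
  apply: (@asym_tperm_eq0 _ _ p (e (match_snd i0))) => // [|y].
    by rewrite eq_sym.
  by apply: (shared k (match_snd i0) i0) => //; left.
apply: (@asym_tperm_eq0 _ _ p (e (match_fst i0))) => // [|y].
  by rewrite eq_sym.
by apply: (shared k (match_fst i0) i0) => //; right.
Qed.

End Generic.

(** * The antisymmetrised kernel is a sum over matchings *)

Section PfaffianFormula.
Variables (F : fieldType) (w : F).
Hypothesis char0 : forall k, k.+1%:R != 0 :> F.

(** The kernel of the antisymmetrisation, read in reverse order of the variables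
    and divided by the symmetric part of the right-hand side. *)
Definition kern n (y : 'I_n -> F) : F :=
  \prod_(i < n) ((1 - y i) / (1 - \prod_(j < n | (i <= j)%N) y j)
     * \prod_(j < n | (i < j)%N)
         ((1 + w * y j + y j * y i) / (y j + y i + w))).

Definition kern_first n (y : 'I_n.+1 -> F) : F :=
  first_factor w y / (1 - \prod_i y i).

Lemma kern_recl n (y : 'I_n.+1 -> F) :
  kern y = kern_first y * kern (fun i => y (lift ord0 i)).
Proof.
rewrite /kern big_ord_recl; congr (_ * _).
  rewrite /kern_first /first_factor mulrAC; congr (_ * _ * _).
  by rewrite big_mkcond big_ord_recl /= mul1r.
apply: eq_bigr => i _; congr (_ / (1 - _) * _).
  by rewrite big_mkcond big_ord_recl /= mul1r [RHS]big_mkcond.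
by rewrite big_mkcond big_ord_recl /= mul1r [RHS]big_mkcond.
Qed.

Lemma kern_first_lift_perm n (x : 'I_n.+1 -> F) j (s : 'S_n) :
  kern_first (fun i => x (lift_perm ord0 j s i))
  = kern_first (fun i => x (lift_perm ord0 j 1%g i)).
Proof.
rewrite /kern_first; congr (_ / (1 - _)); last first.
  by rewrite !prod_perm.
rewrite /first_factor !lift_perm_id; congr (_ * _).
rewrite [LHS](reindex_inj (@perm_inj _ s^-1%g)) /=; apply: eq_bigr => i _.
by rewrite !lift_perm_lift permKV perm1.
Qed.

(** The factor [kern_first] is symmetric in all variables but the first, so the
    induction hypothesis applies to the rest. *)
Lemma asym_kern_step n c (G : ('I_n -> F) -> F) (x : 'I_n.+1 -> F) :
    generic w x ->
    (forall z, generic w z -> c * asym (@kern n) z = asym G z) ->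
  c * asym (@kern n.+1) x = asym (fun y => kern_first y * G (fun i => y (lift ord0 i))) x.
Proof.
move=> gx IH.
rewrite (eq_asym (H := fun y => kern_first y * kern (fun i => y (lift ord0 i))))
  => [|s]; last exact: kern_recl.
rewrite !asym_mul_first; try exact: kern_first_lift_perm.
rewrite mulr_sumr; apply: eq_bigr => j _.
rewrite mulrCA [c * _]mulrCA IH //.
by apply: generic_comp gx; apply: lift_inj.
Qed.

Lemma kern_first_decomp n (y : 'I_n.+1 -> F) : generic w y ->
  kern_first y = \sum_(k < n) pf_kernel w (y ord0) (y (lift ord0 k))
                     * (weight y (lift ord0 k) / (1 - \prod_i y i))
                 + ((-1) ^+ n - \prod_i y i) / (1 - \prod_i y i).
Proof.
move=> gy; have [inj_y yDw _] := gy.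
rewrite /kern_first first_factor_decomp //.
- by rewrite mulrDl mulr_suml; congr (_ + _); apply: eq_bigr => k _; rewrite mulrA.
- by move=> k; apply: generic_neq1 gy.
by move=> i j; apply: generic_mul_neq1 gy.
Qed.

Lemma weight_tperm_id n (y : 'I_n -> F) (p q k : 'I_n) : k != p -> q != k ->
  weight (fun i => y (tperm p q i)) k / (1 - \prod_i y (tperm p q i))
  = weight y k / (1 - \prod_i y i).
Proof.
by move=> neq_kp neq_qk; rewrite weight_perm prod_perm tpermD // eq_sym.
Qed.

Definition pairs m (y : 'I_(m.*2) -> F) : F :=
  \prod_(k < m) pf_kernel w (y (match_fst k)) (y (match_snd k)).

(** Every k in the decomposition of the first factor belongs to a pair, so only
    the constant term (1 - prod y)/(1 - prod y) = 1 survives. *)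
Lemma asym_kern_odd m c (x : 'I_(m.*2.+1) -> F) : generic w x ->
    (forall z, generic w z -> c * asym (@kern m.*2) z = asym (@pairs m) z) ->
  c * asym (@kern m.*2.+1) x = asym (fun y => pairs (fun i => y (lift ord0 i))) x.
Proof.
move=> gx IH; rewrite (asym_kern_step gx IH).
rewrite (eq_asym (H := fun y =>
    \sum_(k < m.*2) (pf_kernel w (y ord0) (y (lift ord0 k))
       * (weight y (lift ord0 k) / (1 - \prod_i y i))
       * pairs (fun i => y (lift ord0 i)))
     + pairs (fun i => y (lift ord0 i)))) => [|s]; last first.
  have gxs := generic_comp (@perm_inj _ s) gx.
  rewrite (kern_first_decomp gxs) -signr_odd odd_double expr0.
  by rewrite divff ?(generic_prod_neq1 gxs) // mulrDl mul1r mulr_suml.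
rewrite asymD asym_sum big1 ?add0r // => k _.
apply: (@asym_shared_pair _ w _ _ (lift ord0) ord0 k
  (fun y => weight y (lift ord0 k) / (1 - \prod_i y i))) => //.
  exact: lift_inj.
by move=> y q neq_q; apply: weight_tperm_id => //; rewrite eq_sym neq_lift.
Qed.

Lemma pairs_recl m (y : 'I_(m.+1.*2) -> F) :
  pairs y = pf_kernel w (y ord0) (y (lift ord0 ord0))
            * pairs (fun i => y (lift ord0 (lift ord0 i))).
Proof.
rewrite /pairs big_ord_recl match_fst0 match_snd0; congr (_ * _).
by apply: eq_bigr => k _; rewrite match_fst_lift match_snd_lift.
Qed.

(** Position 1 is unpaired before the step. The terms with k > 1 vanish by
    [asym_shared_pair], and the constant term because it treats positions 0 and
    1 alike. The term k = 1 completes the matching, and averaging its weight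
    over all positions turns it into (1 - prod y)/(1 - prod y) = 1. *)
Lemma asym_kern_even m c (x : 'I_(m.+1.*2) -> F) : generic w x ->
    (forall z, generic w z -> c * asym (@kern m.*2.+1) z
                 = asym (fun y => pairs (fun i => y (lift ord0 i))) z) ->
  (m.+1.*2)%:R * (c * asym (@kern m.+1.*2) x) = asym (@pairs m.+1) x.
Proof.
move=> gx IH; rewrite (asym_kern_step gx IH).
pose W (y : 'I_(m.+1.*2) -> F) k := weight y k / (1 - \prod_i y i).
transitivity ((m.+1.*2)%:R * asym (fun y : 'I_(m.+1.*2) -> F =>
    pairs y * W y (lift ord0 ord0)
    + (\sum_(k < m.*2) (pf_kernel w (y ord0) (y (lift ord0 (lift ord0 k)))
         * W y (lift ord0 (lift ord0 k))
         * pairs (fun i => y (lift ord0 (lift ord0 i))))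
       + (-1 - \prod_i y i) / (1 - \prod_i y i)
         * pairs (fun i => y (lift ord0 (lift ord0 i))))) x).
  congr (_ * _); apply: eq_asym => s.
  have gxs := generic_comp (@perm_inj _ s) gx.
  rewrite (@kern_first_decomp m.*2.+1 (fun i => x (s i)) gxs).
  rewrite -signr_odd /= odd_double expr1 big_ord_recl.
  by rewrite pairs_recl /W -mulr_suml; ring.
rewrite !asymD asym_sum big1 => [|k _]; last first.
  apply: (@asym_shared_pair _ w _ _ (lift ord0 \o lift ord0) ord0 k
    (fun y => W y (lift ord0 (lift ord0 k)))) => //=.
    exact: inj_comp lift_inj lift_inj.
  by move=> y q neq_q; apply: weight_tperm_id => //; rewrite eq_sym neq_lift.
rewrite add0r [X in _ + X](@asym_tperm_eq0 _ _ ord0 (lift ord0 ord0)) // => [|y]; last first.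
  rewrite /= prod_perm.
  congr (_ * pairs _); apply: functional_extensionality => i.
  by rewrite tpermD // (inj_eq lift_inj) neq_lift.
rewrite addr0 /asym /pairs.
rewrite (sum_pairing_position (a := fun i j => pf_kernel w (x i) (x j))
   (W := fun s => W (fun i => x (s i)))); first last.
- move=> h s q; rewrite /W; congr (_ / (1 - _)).
    rewrite -(weight_perm (fun i => x (s i))); congr (weight _ _).
    by apply: functional_extensionality => i; rewrite permM.
  rewrite -[RHS](prod_perm (fun i => x (s i)) h).
  by apply: eq_bigr => i _; rewrite permM.
- by move=> i j; apply: pf_kernelC.
apply: eq_bigr => s _; congr (_ * _); rewrite /W -mulr_suml.
have gxs := generic_comp (@perm_inj _ s) gx.
have [inj_xs _ _] := gxs.
rewrite sum_weight // => [|k]; last exact: generic_neq1 gxs.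
rewrite -signr_odd odd_double expr0 divff ?mulr1 //.
exact: generic_prod_neq1 gxs.
Qed.

Lemma asym_kern_pairs m :
  (forall x : 'I_(m.*2) -> F, generic w x ->
     (even_factorial m)%:R * asym (@kern m.*2) x = asym (@pairs m) x)
  /\ (forall x : 'I_(m.*2.+1) -> F, generic w x ->
     (even_factorial m)%:R * asym (@kern m.*2.+1) x
     = asym (fun y => pairs (fun i => y (lift ord0 i))) x).
Proof.
suff even_case (x : 'I_(m.*2) -> F) : generic w x ->
     (even_factorial m)%:R * asym (@kern m.*2) x = asym (@pairs m) x.
  by split=> // x gx; apply: asym_kern_odd.
elim: m x => [|m IHm] x gx.
  rewrite /even_factorial big_ord0 mul1r; apply: eq_asym => s.
  by rewrite /kern /pairs !big_ord0.
rewrite even_factorialS natrM -mulrA; apply: asym_kern_even => // z gz.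
exact: asym_kern_odd.
Qed.

End PfaffianFormula.

(** * The identity of rational functions *)

Section PairProducts.
Variable R : comPzRingType.

Definition prod_lt n (H : 'I_n -> 'I_n -> R) : R :=
  \prod_(i < n) \prod_(j < n | (i < j)%N) H i j.

Lemma eq_prod_lt n (H K : 'I_n -> 'I_n -> R) :
  (forall i j : 'I_n, (i < j)%N -> H i j = K i j) -> prod_lt H = prod_lt K.
Proof.
by move=> eqHK; apply: eq_bigr => i _; apply: eq_bigr => j /eqHK.
Qed.

Lemma prod_ltM n (H K : 'I_n -> 'I_n -> R) :
  prod_lt (fun i j => H i j * K i j) = prod_lt H * prod_lt K.
Proof.
by rewrite /prod_lt -big_split; apply: eq_bigr => i _; rewrite big_split.
Qed.

Lemma prod_lt_rev n (H : 'I_n -> 'I_n -> R) :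
  prod_lt (fun i j => H (rev_ord i) (rev_ord j)) = prod_lt (fun i j => H j i).
Proof.
rewrite /prod_lt (reindex_inj rev_ord_inj) /=.
under eq_bigr => i _ do rewrite (reindex_inj rev_ord_inj) /=.
rewrite (exchange_big_dep predT) //=; apply: eq_bigr => i _.
apply: eq_big => [j | j _]; last by rewrite !rev_ordK.
by have := ltn_ord i; have := ltn_ord j; lia.
Qed.

(** A product over unordered pairs: for each pair, exactly one of the two
    orders is increasing after relabelling by s. *)
Lemma prod_lt_sym n (H : 'I_n -> 'I_n -> R) (s : 'S_n) :
  (forall i j, H i j = H j i) ->
  prod_lt (fun i j => H (s i) (s j)) = prod_lt H.
Proof.
move=> HC.
(* G selects, for each ordered pair, whether it is increasing before s. *)
pose G (i j : 'I_n) : R := if ((s^-1)%g i < (s^-1)%g j)%N then H i j else 1.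
transitivity (\prod_i \prod_j G i j).
  rewrite [RHS](reindex_inj (@perm_inj _ s)); apply: eq_bigr => i _.
  rewrite [RHS](reindex_inj (@perm_inj _ s)) big_mkcond; apply: eq_bigr => j _.
  by rewrite /G !permK.
transitivity (prod_lt (fun i j => G i j * G j i)).
  rewrite prod_ltM /prod_lt [X in _ * X](exchange_big_dep predT) //= -big_split.
  apply: eq_bigr => i _ /=; rewrite (bigID (fun j : 'I_n => (i < j)%N)) /=.
  congr (_ * _); rewrite (bigID (fun j : 'I_n => (j < i)%N)) /=.
  rewrite [X in _ * X]big1 => [|j]; last first.
    rewrite -!leqNgt -eqn_leq => /eqP/val_inj ->.
    by rewrite /G ltnn.
  by rewrite mulr1; apply: eq_bigl => j; rewrite andb_idl //; case: ltngtP.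
apply: eq_prod_lt => i j lt_ij; rewrite /G (HC j i).
have : (s^-1)%g i != (s^-1)%g j.
  by rewrite (inj_eq perm_inj) neq_ltn lt_ij.
by rewrite neq_ltn => /orP[] lt_s; rewrite lt_s ltnNge ltnW //= ?mul1r ?mulr1.
Qed.

(** The product is a Vandermonde determinant, whose columns are permuted. *)
Lemma prod_lt_vandermonde_perm n (x : 'I_n -> R) (s : 'S_n) :
  prod_lt (fun i j => x (s j) - x (s i))
  = (-1) ^+ s * prod_lt (fun i j => x j - x i).
Proof.
have det_prod (y : 'I_n -> R) :
    prod_lt (fun i j => y j - y i) = \det (Vandermonde n (\row_j y j)).
  by rewrite det_Vandermonde; apply: eq_prod_lt => i j _; rewrite !mxE.
rewrite !det_prod.
have -> : Vandermonde n (\row_j x (s j)) = col_perm s (Vandermonde n (\row_j x j)).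
  by apply/matrixP=> i j; rewrite !mxE.
by rewrite col_permE det_mulmx det_perm odd_permV mulrC.
Qed.

End PairProducts.

Section RationalIdentity.
Variables (F : fieldType) (w : F).
Hypothesis char0 : forall k, k.+1%:R != 0 :> F.

Lemma eq_pfaffian m (a b : 'I_(m.*2) -> 'I_(m.*2) -> F) :
  (forall i j, a i j = b i j) -> pfaffian a = pfaffian b.
Proof.
move=> eq_ab; apply: eq_bigr => s _; congr (_ * _).
by apply: eq_bigr => k _; rewrite eq_ab.
Qed.

Lemma pfaffian_chi_uphalf n m (a : 'I_n.+1 -> 'I_n.+1 -> F) :
  uphalf n = m ->
  pfaffian_chi a = pfaffian (fun p q : 'I_(m.*2) =>
    a (inord (p + chi_even n)) (inord (q + chi_even n))).
Proof. by move=> <-. Qed.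

Lemma pf_entry_lift n (x : 'I_n -> F) i j :
  pf_entry x w (lift ord0 i) (lift ord0 j) = pf_kernel w (x i) (x j).
Proof. by rewrite /pf_entry !liftK. Qed.

Lemma pf_entry0 n (x : 'I_n -> F) j : pf_entry x w ord0 j = 1.
Proof. by rewrite /pf_entry unlift_none. Qed.

Lemma even_factorial_neq0 m : (even_factorial m)%:R != 0 :> F.
Proof.
have: (0 < even_factorial m)%N by rewrite prodn_gt0.
by case: (even_factorial m) => // k _.
Qed.

(** In the odd case the row of ones is the first row, and its expansion leaves
    unpaired exactly the variable at position 0. *)
Lemma pfaffian_chi_asym n (x : 'I_n -> F) : generic w x ->
  pfaffian_chi (pf_entry x w) = asym (kern w (n := n)) x.
Proof.
move=> gx; have := odd_double_half n; move: n./2 => m.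
case: (odd n); rewrite ?add1n ?add0n => def_n;
  apply: (mulfI (even_factorial_neq0 m)).
  subst n; have [_ kernE] := asym_kern_pairs w char0 m; rewrite {}kernE //.
  rewrite (pfaffian_chi_uphalf (m := m.+1)) /chi_even /= ?doubleK ?odd_double //.
  rewrite pfaffian_expand mulr_sumr.
  rewrite (eq_asym (H := fun y => 1 * pairs w (fun i => y (lift ord0 i))))
    => [|s]; last by rewrite mul1r.
  rewrite (asym_mul_first (B := fun=> 1)) //.
  apply: eq_bigr => j _; rewrite mulrCA; congr (_ * _).
  have inordE (p : 'I_(m.+1.*2)) : inord (p + 0) = p :> 'I_(m.*2.+2).
    by rewrite addn0 inord_val.
  rewrite !inordE pf_entry0 !mul1r.
  under eq_pfaffian => p q do rewrite !inordE pf_entry_lift.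
  by rewrite even_factorial_pfaffian // => p q; apply: pf_kernelC.
subst n; have [kernE _] := asym_kern_pairs w char0 m; rewrite {}kernE //.
rewrite (pfaffian_chi_uphalf (m := m)) /chi_even ?uphalf_double ?odd_double //=.
have inordE (p : 'I_(m.*2)) : inord (p + 1) = lift ord0 p :> 'I_(m.*2.+1).
  by apply: val_inj; rewrite /= inordK ?addn1 // ltnS.
under eq_pfaffian => p q do rewrite !inordE pf_entry_lift.
by rewrite even_factorial_pfaffian // => p q; apply: pf_kernelC.
Qed.

(** The summand of the antisymmetrisation after the geometric sums over k. *)
Definition summed_kernel n (y : 'I_n -> F) : F :=
  prod_lt (fun i j => 1 * y i * y j + 1 + w * y i)
  * \prod_(i < n) (1 - \prod_(j < n | (j <= i)%N) y j)^-1.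

Lemma asym_perm n (G : ('I_n -> F) -> F) (x : 'I_n -> F) (s : 'S_n) :
  asym (fun y => G (fun i => y (s i))) x = (-1) ^+ s * asym G x.
Proof.
rewrite /asym [in RHS](reindex_inj (mulgI s)) mulr_sumr /=.
apply: eq_bigr => t _; rewrite odd_permM signr_addb !mulrA -expr2 sqrr_sign mul1r.
by congr (_ * G _); apply: functional_extensionality => i; rewrite permM.
Qed.

Lemma summed_kernel_rev n (y : 'I_n -> F) :
  summed_kernel (fun i => y (rev_ord i))
  = prod_lt (fun i j => 1 + w * y j + y j * y i)
    * \prod_(i < n) (1 - \prod_(j < n | (i <= j)%N) y j)^-1.
Proof.
rewrite /summed_kernel; congr (_ * _).
  rewrite (prod_lt_rev (fun i j => 1 * y i * y j + 1 + w * y i)).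
  by apply: eq_prod_lt => i j _; ring.
rewrite (reindex_inj rev_ord_inj); apply: eq_bigr => i _; congr (1 - _)^-1.
rewrite (reindex_inj rev_ord_inj) /=; apply: eq_big => [j | j _].
  by have := ltn_ord i; have := ltn_ord j; lia.
by rewrite rev_ordK.
Qed.

(** Reversing the variables turns [summed_kernel] into [kern] times symmetric
    factors; the sign of the reversal is what changes the products of the
    x_j - x_i into products of the x_i - x_j. *)
Lemma summed_kernelE n (x : 'I_n -> F) : generic w x ->
  (\prod_(i < n) (1 - x i)^-1) * prod_lt (fun i j => (x i + x j + w) / (x i - x j))
    * pfaffian_chi (pf_entry x w)
  = asym (@summed_kernel n) x / prod_lt (fun i j => x j - x i).
Proof.
move=> gx; rewrite pfaffian_chi_asym //; have [inj_x xDw _] := gx.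
pose r : 'S_n := perm (@rev_ord_inj n).
have rE i : r i = rev_ord i by rewrite permE.
have sign_r : prod_lt (fun i j => x i - x j) = (-1) ^+ r * prod_lt (fun i j => x j - x i).
  rewrite -prod_lt_vandermonde_perm -(prod_lt_rev (fun i j => x j - x i)).
  by apply: eq_prod_lt => i j _; rewrite !rE.
have prod_ltV (H : 'I_n -> 'I_n -> F) : prod_lt (fun i j => (H i j)^-1) = (prod_lt H)^-1.
  by rewrite /prod_lt -prodfV; apply: eq_bigr => i _; rewrite prodfV.
rewrite prod_ltM prod_ltV sign_r invfM.
have -> : ((-1) ^+ r)^-1 = (-1) ^+ r :> F by rewrite invr_sign.
rewrite [RHS]mulrC; set V := prod_lt (fun i j => x j - x i).
have regroup (p q e v a : F) : p * (q * (e * v)) * a = v * (e * (p * q * a)).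
  by ring.
rewrite regroup.
congr (_ * _); apply: (canLR (signrMK r)); rewrite -asym_perm.
rewrite /asym mulr_sumr; apply: eq_bigr => s _; rewrite mulrCA; congr (_ * _).
have gxs := generic_comp (@perm_inj _ s) gx.
have -> : (fun i => x (s (r i))) = (fun i => x (s (rev_ord i))).
  by apply: functional_extensionality => i; rewrite rE.
rewrite (summed_kernel_rev (fun i => x (s i))) /kern big_split /= big_split /=.
rewrite -/(prod_lt _) prod_ltM prod_ltV.
have -> : prod_lt (fun i j => x (s j) + x (s i) + w) = prod_lt (fun i j => x i + x j + w).
  rewrite (prod_lt_sym (H := fun i j => x j + x i + w)) => [|i j]; last first.
    by rewrite (addrC (x j)).
  by apply: eq_prod_lt => i j _; rewrite (addrC (x j)).
rewrite (prod_perm (fun i => 1 - x i)) prodfV.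
have S_neq0 : prod_lt (fun i j => x i + x j + w) != 0.
  apply/prodf_neq0 => i _; apply/prodf_neq0 => j lt_ij; apply: xDw.
  by rewrite neq_ltn lt_ij.
have P_neq0 : \prod_i (1 - x i) != 0.
  by apply/prodf_neq0 => i _; rewrite subr_eq0 eq_sym; apply: generic_neq1 gx.
have cancel_weights (p q a b : F) : p != 0 -> q != 0 ->
    p^-1 * q * (p * a * (b / q)) = b * a.
  by move=> p0 q0; field; rewrite p0 q0.
exact: cancel_weights.
Qed.

End RationalIdentity.

(** * Divisibility by the Vandermonde product *)

Section VandermondeDivides.

(** By the factor theorem f_j(x_i) = f_j(x_0) + (x_i - x_0) g_j(x_i), so the
    matrix is the product of a triangular matrix with diagonal 1, x_i - x_0 and
    a matrix whose minors along the first row are of the same kind, with one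
    variable less. *)
Lemma det_horner_vandermonde (R : comNzRingType) n (x : 'I_n -> R)
    (f : 'I_n -> {poly R}) :
  exists q, \det (\matrix_(i, j) (f j).[x i]) = q * prod_lt (fun i j => x j - x i).
Proof.
elim: n x f => [|n IHn] x f.
  by exists 1; rewrite det_mx00 /prod_lt big_ord0 mulr1.
pose x0 := x ord0.
have [g gP] : exists g : 'I_n.+1 -> {poly R},
    forall j, f j - (f j).[x0]%:P = g j * ('X - x0%:P).
  have quoP j : exists q, f j - (f j).[x0]%:P = q * ('X - x0%:P).
    by apply/factor_theorem; rewrite rootE !hornerE subrr.
  exact: fin_all_exists quoP.
(* Row i is row 0 plus x_i - x_0 times the row of quotients g_j(x_i). *)
pose L := \matrix_(i < n.+1, j < n.+1)
  if j == ord0 then 1 else if i == j then x i - x0 else 0.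
pose C := \matrix_(i < n.+1, j < n.+1)
  if i == ord0 then (f j).[x0] else (g j).[x i].
have -> : \matrix_(i, j) (f j).[x i] = L *m C.
  apply/matrixP=> i j; rewrite !mxE big_ord_recl !mxE eqxx mul1r.
  have -> : (f j).[x i] = (f j).[x0] + (g j).[x i] * (x i - x0).
    by have /(congr1 (horner^~ (x i))) := gP j; rewrite !hornerE => <-; rewrite subrKC.
  congr (_ + _); have [i'|] := unliftP ord0 i => ->; last first.
    by rewrite subrr mulr0 big1 // => k _; rewrite !mxE mul0r.
  rewrite (bigD1 i') //= !mxE eqxx mulrC big1 ?addr0 // => k neq_k.
  by rewrite !mxE /= (inj_eq lift_inj) [i' == k]eq_sym (negPf neq_k) mul0r.
rewrite det_mulmx det_trig; last first.
  apply/is_trig_mxP=> i j lt_ij; rewrite mxE.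
  have [j0|_] := eqVneq; first by rewrite j0 ltn0 in lt_ij.
  by rewrite -val_eqE /= ltn_eqF.
rewrite (expand_det_row C ord0).
have [q qP] : exists q : 'I_n.+1 -> R, forall j, cofactor C ord0 j
    = q j * prod_lt (fun i j => x (lift ord0 j) - x (lift ord0 i)).
  suff quoP j : exists q, cofactor C ord0 j
      = q * prod_lt (fun i j => x (lift ord0 j) - x (lift ord0 i)).
    exact: fin_all_exists quoP.
  have [q qP] := IHn (fun i => x (lift ord0 i)) (fun k => g (lift j k)).
  exists ((-1) ^+ (0 + j) * q); rewrite /cofactor -mulrA -qP; congr (_ * \det _).
  by apply/matrixP=> i k; rewrite !mxE.
exists (\sum_j C ord0 j * q j); rewrite mulr_suml mulr_sumr.
apply: eq_bigr => j _; rewrite qP big_ord_recl !mxE eqxx mul1r.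
rewrite /prod_lt big_ord_recl [in RHS]big_mkcond big_ord_recl /= mul1r.
rewrite mulrCA -mulrA; congr (_ * _); rewrite mulrCA; congr (_ * (_ * _)).
  by apply: eq_bigr => i _; rewrite !mxE eqxx.
apply: eq_bigr => i _.
by rewrite [RHS]big_mkcond big_ord_recl /= mul1r big_mkcond.
Qed.

Variables (n : nat) (R : idomainType).

Definition vandermonde : {mpoly R[n]} := prod_lt (fun i j => 'X_j - 'X_i).

Definition antisymmetrize (p : {mpoly R[n]}) : {mpoly R[n]} :=
  \sum_(s : 'S_n) (-1) ^+ s * msym s p.

(** On a monomial the antisymmetrisation is the determinant of the x_i^(m_j).
    Equality is boolean so that a quotient can be chosen by [xchoose]. *)
Lemma antisymmetrize_vandermonde p : exists q, antisymmetrize p == q * vandermonde.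
Proof.
suff [q ->] : exists q, antisymmetrize p = q * vandermonde by exists q.
rewrite /antisymmetrize; elim/mpolyind: p => [|c m p _ _ [q def_q]].
  by exists 0; rewrite mul0r big1 // => s _; rewrite msym0 mulr0.
have [r def_r] :=
  det_horner_vandermonde (fun i : 'I_n => 'X_i : {mpoly R[n]}) (fun j => 'X^(m j)).
exists (c *: r + q); rewrite mulrDl -def_q -scalerAl -[r * _]def_r.
rewrite -det_tr /determinant scaler_sumr -!big_split /=; apply: eq_bigr => s _.
rewrite msymD msymZ msymX mulrDr; congr (_ + _).
rewrite -scalerAr; congr (_ *: (_ * _)).
rewrite (mpolyXE _ s); apply: eq_bigr => i _.
by rewrite !mxE hornerXn mnmE permK.
Qed.

Definition antisym_quo p : {mpoly R[n]} := xchoose (antisymmetrize_vandermonde p).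

Lemma antisym_quoK p : antisymmetrize p = antisym_quo p * vandermonde.
Proof. exact/eqP/(xchooseP (antisymmetrize_vandermonde p)). Qed.

Lemma vandermonde_neq0 : vandermonde != 0.
Proof.
apply/prodf_neq0 => i _; apply/prodf_neq0 => j lt_ij.
apply/eqP => /(congr1 (fun p : {mpoly R[n]} => p@_(U_(j)))) /eqP.
rewrite mcoeffB !mcoeffXU mcoeff0 eqxx -val_eqE /= ltn_eqF // subr0.
by rewrite oner_eq0.
Qed.

Lemma vandermonde_homog : exists d, vandermonde \is d.-homog for mdeg.
Proof.
have homM (p q : {mpoly R[n]}) : (exists d, p \is d.-homog for mdeg) ->
    (exists d, q \is d.-homog for mdeg) -> exists d, p * q \is d.-homog for mdeg.
  by move=> [d pd] [e qe]; exists (d + e)%N; apply: dhomogM.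
have hom1 : exists d, (1 : {mpoly R[n]}) \is d.-homog for mdeg.
  by exists 0%N; apply: dhomog1.
pose K (p : {mpoly R[n]}) := exists d, p \is d.-homog for mdeg.
apply: (big_ind K) => // i _; apply: (big_ind K) => // j _; exists 1%N.
by rewrite rpredB // dhomogX /= mdeg1.
Qed.

End VandermondeDivides.

(** * Low-order terms, and truncated sums over weakly decreasing sequences *)

Section LowOrder.
Variables (n : nat) (R : idomainType).
Implicit Types p q : {mpoly R[n]}.

(** Membership in the d-th power of the ideal of the variables; congruence
    modulo these powers takes the place of arithmetic with power series. *)
Definition order_ge d p : Prop := forall m : 'X_{1..n}, (mdeg m < d)%N -> p@_m = 0.

Lemma order_ge0 d : order_ge d 0.
Proof. by move=> m _; rewrite mcoeff0. Qed.

Lemma order_geD d p q : order_ge d p -> order_ge d q -> order_ge d (p + q).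
Proof. by move=> dp dq m lt_m; rewrite mcoeffD dp // dq // addr0. Qed.

Lemma order_ge_sum d (I : Type) (r : seq I) (G : I -> {mpoly R[n]}) :
  (forall i, order_ge d (G i)) -> order_ge d (\sum_(i <- r) G i).
Proof.
by move=> dG; apply: (big_ind (order_ge d)) => [||i _];
  [apply: order_ge0 | apply: order_geD | apply: dG].
Qed.

Lemma order_geM d p q : order_ge d q -> order_ge d (p * q).
Proof.
move=> dq m lt_m; rewrite (@mcoeff_poly_mul_lin _ _ p q m _ (ltnSn _)) big1 // => a _.
by rewrite dq ?mulr0 // (leq_ltn_trans (mdegB _ _)).
Qed.

Lemma order_ge_mpolyX d (m : 'X_{1..n}) : (d <= mdeg m)%N -> order_ge d 'X_[m].
Proof.
move=> le_d m' lt_m'; rewrite mcoeffX; case: eqP => // def_m.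
by rewrite -def_m ltnNge le_d in lt_m'.
Qed.

Lemma order_ge_prodB1 d (I : Type) (r : seq I) (G : I -> {mpoly R[n]}) :
  (forall i, order_ge d (G i - 1)) -> order_ge d (\prod_(i <- r) G i - 1).
Proof.
move=> dG; elim/big_rec: _ => [|i p _ dp]; first by rewrite subrr; apply: order_ge0.
have -> : G i * p - 1 = G i * (p - 1) + (G i - 1) by ring.
by apply: order_geD => //; apply: order_geM.
Qed.

Lemma mcoeff_pihomog d p m : (pihomog mdeg d p)@_m = if mdeg m == d then p@_m else 0.
Proof.
elim/mpolyind: p => [|c m' p _ _ IHp]; first by rewrite pihomog0 mcoeff0 if_same.
rewrite pihomogD linearZ /= !mcoeffD !mcoeffZ IHp pihomogX.
rewrite (fun_if (mcoeff m)) !mcoeffX mcoeff0.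
have [->|_] := eqVneq m' m; first by case: ifP => _; rewrite ?mulr0 ?addr0.
by rewrite if_same !mulr0 !add0r.
Qed.

Lemma pihomogM_homog c d p q : p \is c.-homog for mdeg ->
  pihomog mdeg (d + c) (q * p) = pihomog mdeg d q * p.
Proof.
move=> homp; elim/mpolyind: q => [|a m q _ _ IHq].
  by rewrite mul0r !pihomog0 mul0r.
rewrite mulrDl !pihomogD IHq mulrDl -scalerAl !linearZ /= -scalerAl; congr (_ *: _ + _).
have homXp : 'X_[m] * p \is (mdeg m + c).-homog for mdeg.
  by apply: dhomogM => //; rewrite dhomogX.
rewrite pihomogX; case: eqP => [<-|/eqP neq_m]; first exact: pihomog_dE.
by rewrite (@pihomog_ne0 _ _ _ _ _ _ _ homXp) ?mul0r // eqn_add2r.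
Qed.

(** The homogeneous component of degree e + c of p * q is the component of
    degree e of p times q, and the ring is a domain. *)
Lemma order_ge_cancel_homog c d p q :
  q != 0 -> q \is c.-homog for mdeg -> order_ge (d + c) (p * q) -> order_ge d p.
Proof.
move=> q_neq0 homq dpq m lt_m.
have : pihomog mdeg (mdeg m) p * q = 0.
  rewrite -(pihomogM_homog _ _ homq); apply/mpolyP => m'.
  rewrite mcoeff0 mcoeff_pihomog; case: eqP => // def_m'.
  by apply: dpq; rewrite def_m' ltn_add2r.
move/eqP; rewrite mulf_eq0 (negPf q_neq0) orbF => /eqP/(congr1 (mcoeff m)).
by rewrite mcoeff0 mcoeff_pihomog eqxx.
Qed.

Lemma order_ge_msym d p (s : 'S_n) : order_ge d p -> order_ge d (msym s p).
Proof. by move=> dp m lt_m; rewrite mcoeff_sym dp // mdeg_mperm. Qed.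

Lemma order_ge_antisymmetrize d p : order_ge d p -> order_ge d (antisymmetrize p).
Proof.
by move=> dp; apply: order_ge_sum => s; apply: order_geM; apply: order_ge_msym.
Qed.

End LowOrder.

Section WeaklyDecreasing.
Variable n : nat.

Lemma nth_mktuple_nat (f : 'I_n -> nat) i (lt_i : (i < n)%N) :
  nth 0%N [tuple f j | j < n] i = f (Ordinal lt_i).
Proof. by rewrite -[i]/(val (Ordinal lt_i)) -tnth_nth tnth_mktuple. Qed.

Lemma tails_sorted M (e : {ffun 'I_n -> 'I_M.+1}) :
  sorted geq [tuple (\sum_(j < n | i <= j) e j)%N | i < n].
Proof.
apply/(sortedP 0%N) => i; rewrite size_tuple => lt_i.
rewrite (nth_mktuple_nat _ lt_i) (nth_mktuple_nat _ (ltnW lt_i)) /=.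
rewrite [X in (_ <= X)%N](bigID (fun j : 'I_n => (i < j)%N)) /=.
rewrite (eq_bigl (fun j : 'I_n => (i <= j)%N && (i < j)%N)) ?leq_addr // => j.
by case: ltngtP.
Qed.

(** Weakly decreasing sequences are the sequences of tail sums k_i = e_i + ... +
    e_(n-1) of arbitrary step sequences e, here with steps at most M. *)
Definition tails M (e : {ffun 'I_n -> 'I_M.+1}) : wdec_seq n :=
  exist (fun k : n.-tuple nat => sorted geq k) _ (tails_sorted e).

Lemma tailsE M (e : {ffun 'I_n -> 'I_M.+1}) i :
  tnth (val (tails e)) i = (\sum_(j < n | i <= j) e j)%N.
Proof. by rewrite tnth_mktuple. Qed.

Lemma tails_step M (e : {ffun 'I_n -> 'I_M.+1}) i :
  tnth (val (tails e)) i = (e i + nth 0%N (val (tails e)) i.+1)%N.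
Proof.
rewrite tailsE (bigD1 i) //=; congr (_ + _)%N.
have [lt_i | le_n] := ltnP i.+1 n.
  rewrite (nth_mktuple_nat _ lt_i) /=; apply: eq_bigl => j.
  by rewrite -val_eqE /=; case: ltngtP.
rewrite nth_default; last by rewrite size_tuple card_ord.
rewrite big_pred0 // => j.
by rewrite -val_eqE /=; have := ltn_ord j; case: ltngtP => //; lia.
Qed.

Lemma tails_inj M : injective (@tails M).
Proof.
move=> e1 e2 eq_e; apply/ffunP => i; apply: val_inj.
have := tails_step e1 i; rewrite eq_e tails_step => /eqP.
by rewrite eqn_add2r => /eqP.
Qed.

Lemma wdec_seq_step (k : wdec_seq n) i :
  (nth 0%N (val k) i.+1 <= nth 0%N (val k) i)%N.
Proof.
have [lt_i | le_n] := ltnP i.+1 n; last by rewrite nth_default ?size_tuple.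
by have /(sortedP 0%N) := valP k; apply; rewrite size_tuple.
Qed.

(** The steps of k are its successive differences, the value after the last
    entry being 0. *)
Lemma tails_surj M (k : wdec_seq n) :
  (\sum_i tnth (val k) i <= M)%N -> exists e : {ffun 'I_n -> 'I_M.+1}, tails e = k.
Proof.
move=> le_kM; have k_nth (i : 'I_n) : nth 0%N (val k) i = tnth (val k) i.
  by rewrite (tnth_nth 0%N).
pose e := [ffun i : 'I_n =>
  inord (nth 0%N (val k) i - nth 0%N (val k) i.+1) : 'I_M.+1].
have eE i : e i = (nth 0%N (val k) i - nth 0%N (val k) i.+1)%N :> nat.
  rewrite ffunE inordK // ltnS (leq_trans (leq_subr _ _)) // k_nth.
  by rewrite (leq_trans _ le_kM) // (bigD1 i) //= leq_addr.
exists e; apply/val_inj/val_inj/(@eq_from_nth _ 0%N); rewrite !size_tuple // => i _.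
have [d] := ubnP (n - i); elim: d i => // d IHd i lt_d.
have [lt_i | le_n] := ltnP i n; last by rewrite !nth_default ?size_tuple.
have := tails_step e (Ordinal lt_i); rewrite (tnth_nth 0%N) /= => ->.
rewrite eE /= IHd ?subnK ?wdec_seq_step //.
by move: lt_d lt_i; lia.
Qed.

Definition wdec_below M : seq (wdec_seq n) := [seq tails e | e : {ffun 'I_n -> 'I_M.+1}].

Lemma wdec_below_uniq M : uniq (wdec_below M).
Proof. by rewrite map_inj_uniq ?enum_uniq //; apply: tails_inj. Qed.

Lemma notin_wdec_below M (k : wdec_seq n) :
  k \notin wdec_below M -> (M < \sum_i tnth (val k) i)%N.
Proof.
apply: contraR; rewrite -leqNgt => /tails_surj[e <-].
by apply/mapP; exists e; rewrite ?mem_enum.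
Qed.

(** In terms of the steps e, the monomial y^k is prod_i (y_0 ... y_i)^(e_i), so
    the sum is a product of truncated geometric series. *)
Lemma sum_wdec_below (R : comPzRingType) (y : 'I_n -> R) M :
  (\prod_(i < n) (1 - \prod_(j < n | (j <= i)%N) y j))
    * \sum_(k <- wdec_below M) \prod_i y i ^+ tnth (val k) i
  = \prod_(i < n) (1 - (\prod_(j < n | (j <= i)%N) y j) ^+ M.+1).
Proof.
pose z (i : 'I_n) := \prod_(j < n | (j <= i)%N) y j.
have -> : \sum_(k <- wdec_below M) \prod_i y i ^+ tnth (val k) i
    = \prod_i \sum_(a < M.+1) z i ^+ a.
  rewrite big_map big_enum bigA_distr_bigA /=; apply: eq_bigr => e _.
  under eq_bigr => i _ do rewrite tailsE -prodrXr.
  rewrite (exchange_big_dep predT) //=; apply: eq_bigr => i _.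
  by rewrite prodrXl.
rewrite -big_split; apply: eq_bigr => i _ /=.
by rewrite -/(z i) -[RHS]opprB subrX1 -mulNr opprB.
Qed.

End WeaklyDecreasing.

(** * Expansion as power series *)

Section Assembly.
Variable n : nat.
Notation P := {mpoly {poly int}[n]}.
Notation X i := ('X_i : P).
Notation W := (('X : {poly int})%:MP : P).
Notation x := (@xvar n).
Notation w := (wvar n).

Lemma ratfun_char0 k : k.+1%:R != 0 :> ratfun n.
Proof.
rewrite -(rmorph_nat (@tofrac P)) tofrac_eq0 -(rmorph_nat (@mpolyC n {poly int})).
rewrite mpolyC_eq0 -(rmorph_nat (@polyC int)) polyC_eq0.
by rewrite Num.Theory.pnatr_eq0.
Qed.

Lemma poly_prod_neq1 k (f : 'I_k.+1 -> 'I_n) : \prod_i X (f i) != 1.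
Proof.
apply/eqP => /(congr1 (mcoeff 0%MM)) /eqP.
rewrite rmorph_prod big_ord_recl /= mcoeffX mnm1_eq0 mul0r.
by rewrite mcoeff1 eqxx eq_sym oner_eq0.
Qed.

(** Each inequality of polynomials is read off one coefficient. *)
Lemma xvar_generic : generic w x.
Proof.
split=> [i j|i j neq_ij|k f inj_f].
- move/eqP; rewrite tofrac_eq => /eqP/(congr1 (mcoeff U_(i)%MM)).
  rewrite !mcoeffXU eqxx; case: (eqVneq j i) => // _ /eqP.
  by rewrite mulr1n mulr0n oner_eq0.
- rewrite -!tofracD tofrac_eq0; apply/eqP => /(congr1 (mcoeff U_(i)%MM)) /eqP.
  rewrite !mcoeffD !mcoeffXU mcoeffC eqxx [j == i]eq_sym (negPf neq_ij).
  by rewrite mnm1_eq0 mulr0 !addr0 mcoeff0 oner_eq0.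
rewrite -rmorph_prod -tofrac1 tofrac_eq; exact: poly_prod_neq1.
Qed.

Definition robbins_num : P := prod_lt (fun i j => X i * X j + 1 + W * X i).

(** The denominator of [summed_kernel]. *)
Definition prefix_den : P := \prod_(i < n) (1 - \prod_(j < n | (j <= i)%N) X j).

(** A common denominator of all the terms of the antisymmetrisation, which is
    symmetric and has constant term 1. *)
Definition sym_den : P := \prod_(s : 'S_n) msym s prefix_den.

(** The product of the denominators of the other terms; it clears
    [prefix_den] in the identity term, and its permutations clear the rest. *)
Definition sym_codens : P := \prod_(s : 'S_n | s != (1%g : 'S_n)) msym s prefix_den.

Lemma sym_denE : sym_den = prefix_den * sym_codens.
Proof. by rewrite /sym_den (bigD1 (1%g : 'S_n)) //= msym1m. Qed.

Lemma msym_sym_den s : msym s sym_den = sym_den.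
Proof.
rewrite /sym_den rmorph_prod [RHS](reindex_inj (mulIg s)) /=.
by apply: eq_bigr => t _; rewrite msymMm.
Qed.

Lemma sym_den0 : sym_den@_0%MM = 1.
Proof.
rewrite rmorph_prod big1 //= => s _; rewrite mcoeff_sym.
have -> : [multinom (0%MM : 'X_{1..n}) (s i) | i < n] = 0%MM.
  by apply/mnmP => i; rewrite !mnmE.
rewrite rmorph_prod big1 //= => i _.
rewrite mcoeffB mcoeff1 eqxx rmorph_prod (bigD1 i) //= mcoeffX mnm1_eq0 mul0r.
by rewrite subr0.
Qed.

Lemma sym_den_neq0 : sym_den != 0.
Proof.
apply/eqP => /(congr1 (mcoeff 0%MM)) /eqP.
by rewrite sym_den0 mcoeff0 oner_eq0.
Qed.

Lemma msym_xvar (s : 'S_n) i : tofrac (msym s (X i)) = x (s i).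
Proof. by rewrite /msym mmapX mmap1U. Qed.

Lemma tofrac_prod_lt (H : 'I_n -> 'I_n -> P) :
  tofrac (prod_lt H) = prod_lt (fun i j => tofrac (H i j)).
Proof.
by rewrite rmorph_prod; apply: eq_bigr => i _; rewrite rmorph_prod.
Qed.

Lemma tofrac_vandermonde :
  tofrac (vandermonde n {poly int}) = prod_lt (fun i j => x j - x i).
Proof.
by rewrite tofrac_prod_lt; apply: eq_prod_lt => i j _; rewrite tofracB.
Qed.

Lemma tofrac_antisymmetrize (p : P) :
  tofrac (antisymmetrize p) = \sum_(s : 'S_n) (-1) ^+ s * tofrac (msym s p).
Proof.
rewrite rmorph_sum; apply: eq_bigr => s _.
by rewrite rmorphM rmorph_sign.
Qed.

Lemma tofrac_robbins_num (s : 'S_n) :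
  tofrac (msym s robbins_num)
  = prod_lt (fun i j => 1 * x (s i) * x (s j) + 1 + w * x (s i)).
Proof.
have tofrac_factor (a b c : P) :
    tofrac (a * b + 1 + c * a) = 1 * tofrac a * tofrac b + 1 + tofrac c * tofrac a.
  by rewrite !tofracD !tofracM tofrac1 mul1r.
have msymW : msym s W = W by rewrite /msym mmapC.
have -> : msym s robbins_num
    = prod_lt (fun i j => msym s (X i) * msym s (X j) + 1 + W * msym s (X i)).
  rewrite /robbins_num rmorph_prod; apply: eq_bigr => i _.
  rewrite rmorph_prod; apply: eq_bigr => j _.
  by rewrite !(rmorphD, rmorphM, rmorph1) /= msymW.
rewrite tofrac_prod_lt; apply: eq_prod_lt => i j _.
by rewrite tofrac_factor (msym_xvar s i) (msym_xvar s j).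
Qed.

Lemma tofrac_antisym_quo (p : P) :
  tofrac (antisym_quo p)
  = tofrac (antisymmetrize p) / prod_lt (fun i j => x j - x i).
Proof.
rewrite antisym_quoK rmorphM -tofrac_vandermonde mulfK //.
by rewrite tofrac_eq0 vandermonde_neq0.
Qed.

Definition robbins_poly (k : wdec_seq n) : P :=
  antisym_quo (robbins_num * \prod_i X i ^+ tnth (val k) i).

Lemma robbins_polyE k : robbins (wdec_int k) x 1 1 w = tofrac (robbins_poly k).
Proof.
rewrite tofrac_antisym_quo tofrac_antisymmetrize; congr (_ / _).
apply: eq_bigr => s _.
rewrite !rmorphM /= tofrac_robbins_num; congr (_ * (_ * _)).
rewrite !rmorph_prod; apply: eq_bigr => i _.
by rewrite !rmorphXn /= msym_xvar /wdec_int -exprnP.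
Qed.

Definition sum_num : P := antisym_quo (robbins_num * sym_codens).

Lemma asym_summed_kernel :
  asym (@summed_kernel _ w n) x / prod_lt (fun i j => x j - x i)
  = tofrac sum_num / tofrac sym_den.
Proof.
rewrite tofrac_antisym_quo mulrAC; congr (_ / _).
have D0 : tofrac sym_den != 0 by rewrite tofrac_eq0 sym_den_neq0.
rewrite tofrac_antisymmetrize mulr_suml; apply: eq_bigr => s _.
rewrite -mulrA; congr (_ * _).
rewrite /summed_kernel !rmorphM /= tofrac_robbins_num -mulrA; congr (_ * _).
have -> : \prod_(i < n) (1 - \prod_(j < n | (j <= i)%N) x (s j))^-1
    = (tofrac (msym s prefix_den))^-1.
  rewrite prodfV !rmorph_prod; congr (_^-1); apply: eq_bigr => i _.
  rewrite !rmorphB !rmorph1 !rmorph_prod; congr (1 - _).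
  by apply: eq_bigr => j _; rewrite -msym_xvar.
move: D0; rewrite -(msym_sym_den s) sym_denE rmorphM tofracM /= mulf_eq0.
by case/norP=> den0 codens0; rewrite invfM mulrCA divff ?mulr1.
Qed.

(** Times the Vandermonde product, both terms of the difference are
    antisymmetrisations, and by [sum_wdec_below] the arguments differ by a
    multiple of prod_i (1 - z_i^(M+1)) - 1, where z_i is a prefix product of
    the variables. *)
Lemma sum_robbins_poly M :
  order_ge M.+1 ((sym_den * \sum_(k <- wdec_below n M) robbins_poly k - sum_num)
                 * vandermonde n {poly int}).
Proof.
have -> : (sym_den * \sum_(k <- wdec_below n M) robbins_poly k - sum_num)
                 * vandermonde n {poly int}
    = antisymmetrize (robbins_num * sym_codens
        * (\prod_(i < n) (1 - (\prod_(j < n | (j <= i)%N) X j) ^+ M.+1) - 1)).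
  rewrite -sum_wdec_below -/prefix_den.
  have -> : robbins_num * sym_codens
      * (prefix_den * \sum_(k <- wdec_below n M) \prod_i X i ^+ tnth (val k) i - 1)
    = sym_den * \sum_(k <- wdec_below n M)
        (robbins_num * \prod_i X i ^+ tnth (val k) i) - robbins_num * sym_codens.
    rewrite sym_denE -mulr_sumr; ring.
  rewrite mulrBl -antisym_quoK /antisymmetrize -mulrA mulr_suml.
  transitivity (\sum_(s : 'S_n) ((-1) ^+ s * msym s (sym_den *
     \sum_(k <- wdec_below n M) (robbins_num * \prod_i X i ^+ tnth (val k) i)))
     - \sum_(s : 'S_n) (-1) ^+ s * msym s (robbins_num * sym_codens)).
    congr (_ - _); rewrite (eq_bigr _ (fun k _ => esym (antisym_quoK _))).
    rewrite /antisymmetrize exchange_big mulr_sumr; apply: eq_bigr => s _.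
    by rewrite rmorphM /= msym_sym_den rmorph_sum mulrCA -mulr_sumr.
  by rewrite -sumrB; apply: eq_bigr => s _; rewrite rmorphB mulrBr.
apply/order_ge_antisymmetrize/order_geM/order_ge_prodB1 => i.
rewrite addrAC subrr add0r -mulN1r; apply: order_geM.
rewrite mprodXE mpolyXn; apply: order_ge_mpolyX; rewrite mdegMn mdeg_sum.
by rewrite (bigD1 i) //= mdeg1 mulSn leq_addr.
Qed.

(** Dividing by a homogeneous polynomial of degree c lowers the order by c. This
    makes the sum over k locally finite. *)
Lemma order_ge_robbins_poly c d k : vandermonde n {poly int} \is c.-homog for mdeg ->
  (d + c <= \sum_i tnth (val k) i)%N -> order_ge d (robbins_poly k).
Proof.
move=> homV le_dc; apply: (order_ge_cancel_homog (vandermonde_neq0 _ _) homV).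
rewrite -antisym_quoK; apply/order_ge_antisymmetrize/order_geM.
rewrite mprodXnE; apply: order_ge_mpolyX; rewrite mdeg_sum (leq_trans le_dc) //.
by apply: leq_sum => i _; rewrite mdegMn mdeg1 mul1n.
Qed.

End Assembly.

Lemma eq_sum_support (I : eqType) (V : nmodType) (A B : seq I) (f : I -> V) :
  uniq A -> uniq B -> (forall i, i \notin A -> f i = 0) ->
  (forall i, i \notin B -> f i = 0) -> \sum_(i <- A) f i = \sum_(i <- B) f i.
Proof.
move=> uA uB A0 B0.
rewrite (bigID (mem B)) /= [X in _ + X]big1 ?addr0 => [|i /B0 //].
rewrite [RHS](bigID (mem A)) /= [X in _ = _ + X]big1 ?addr0 => [|i /A0 //].
rewrite -big_filter -[RHS]big_filter; apply/perm_big/uniq_perm; rewrite ?filter_uniq //.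
by move=> i; rewrite !mem_filter andbC.
Qed.

Lemma expands_to_poly n (R : idomainType) (p : {mpoly R[n]}) :
  expands_to (tofrac p) (fps_of_mpoly p).
Proof.
exists p, 1; split=> [||m]; first by rewrite mcoeff1 eqxx unitr1.
  by rewrite tofrac1 divr1.
transitivity ((1 * p)@_m); last by rewrite mul1r.
by rewrite (@mcoeff_poly_mul_lin _ _ 1 p m _ (ltnSn _)).
Qed.

Theorem corollary1p2 (n : nat) (n_gt0 : (0 < n)%N) :
  let x : 'I_n -> ratfun n := @xvar n in
  let w : ratfun n := wvar n in
  exists s : fps n {poly int},
    sums_to (fun k : wdec_seq n => robbins (wdec_int k) x 1 1 w) s
    /\ expands_to
         ((\prod_(i < n) (1 - x i)^-1)
          * (\prod_(i < n) \prod_(j < n | (i < j)%N)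
               ((x i + x j + w) / (x i - x j)))
          * pfaffian_chi (pf_entry x w))
         s.
Proof.
move=> x w; have [c homV] := vandermonde_homog n {poly int}.
(* Division by the Vandermonde product lowers degrees by c, so coefficients of
   degree at most d only involve sequences of sum at most d + c. *)
pose below m := wdec_below n (m + c).
have out_below m M k : (mdeg m <= M)%N -> k \notin below M ->
    fps_of_mpoly (robbins_poly k) m = 0.
  move=> le_mM /notin_wdec_below lt_k.
  by apply: (order_ge_robbins_poly (d := M.+1) homV); rewrite // addSn.
pose s : fps n {poly int} := fun m =>
  \sum_(k <- below (mdeg m)) fps_of_mpoly (robbins_poly k) m.
have sE m M : (mdeg m <= M)%N -> s m = (\sum_(k <- below M) robbins_poly k)@_m.
  move=> le_mM; rewrite raddf_sum; apply: eq_sum_support => [||k|k];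
    by [apply: wdec_below_uniq | apply: out_below].
exists s; split.
  exists (fun k => fps_of_mpoly (robbins_poly k)); split=> [k|m].
    by rewrite robbins_polyE; apply: expands_to_poly.
  exists (below (mdeg m)); split=> // [|k]; first exact: wdec_below_uniq.
  exact: out_below.
exists (sum_num n), (sym_den n); split=> [||m]; first by rewrite sym_den0 unitr1.
  rewrite -asym_summed_kernel.
  exact: (summed_kernelE (@ratfun_char0 n) (xvar_generic n)).
transitivity ((sym_den n * \sum_(k <- below (mdeg m)) robbins_poly k)@_m).
  rewrite (@mcoeff_poly_mul_lin _ _ (sym_den n) _ m _ (ltnSn _)).
  by apply: eq_bigr => a _; rewrite (sE _ (mdeg m)) // mdegB.
apply/eqP; rewrite -subr_eq0 -mcoeffB; apply/eqP.
have := @sum_robbins_poly n (mdeg m + c); rewrite -addSn.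
by move/(order_ge_cancel_homog (vandermonde_neq0 _ _) homV); apply.
Qed.
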